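(* Let $\varphi\colon R\to A$ be a finite ring homomorphism, where $R$ is a Noetherian ring. Suppose that $A$, viewed as a left $R$-module, has finite Gorenstein projective dimension, and that there exists $n\ge 0$ such that $\operatorname{Ext}^i_R(A,R)=0$ for all $i\neq n$. Then for each finitely generated left $A$-module $M$ and each transpose $\operatorname{Tr}_A(M)$ of $M$ over $A$, there exist a Gorenstein transpose $\operatorname{Tr}^G_R(\Omega^n_R(M))$ over $R$ of an $n$-th syzygy $\Omega^n_R(M)$ of $M$ over $R$ and a short exact sequence of right $R$-modules $$0\longrightarrow K\longrightarrow \operatorname{Tr}^G_R(\Omega^n_R(M))\longrightarrow \operatorname{Tr}_A(M)\otimes_A\operatorname{Ext}^n_R(A,R)\longrightarrow 0,$$ where the projective dimension of $K$ is at most $n-1$.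
   Context: A ring is Noetherian if it is left and right Noetherian. Modules are left modules unless stated otherwise; $R^{\mathrm{op}}$-modules are right $R$-modules. A ring homomorphism $R\to A$ is finite if $A$ is finitely generated both as a left and as a right $R$-module (so $A$ is Noetherian if $R$ is). Convention: a module of projective dimension at most $-1$ is the zero module. Transpose: for a finitely generated left $A$-module $M$ and an exact sequence $P_1\xrightarrow{f}P_0\to M\to 0$ with $P_0,P_1$ finitely generated projective, the right $A$-module $\operatorname{Tr}_A(M)=\operatorname{coker}(\operatorname{Hom}_A(f,A)\colon\operatorname{Hom}_A(P_0,A)\to\operatorname{Hom}_A(P_1,A))$ is called a transpose of $M$; it is independent of choices up to projective direct summands. Gorenstein projective: an $R$-module is Gorenstein projective if it is the image of a differential of an acyclic complex $\mathbf P$ of projective $R$-modules such that $\operatorname{Hom}_R(\mathbf P,Q)$ is acyclic for every projective $R$-module $Q$. The Gorenstein projective dimension of $M$ is the least $m$ for which there is an exact sequence $0\to G_m\to\cdots\to G_0\to M\to 0$ with all $G_i$ Gorenstein projective. Gorenstein transpose: for a finitely generated left $R$-module $N$ and an exact sequence $G_1\xrightarrow{g}G_0\to N\to 0$ with $G_0,G_1$ finitely generated Gorenstein projective $R$-modules, the right $R$-module $\operatorname{Tr}^G_R(N)=\operatorname{coker}(\operatorname{Hom}_R(g,R))$ is called a Gorenstein transpose of $N$ (it depends on the chosen presentation). Syzygy: $\Omega^n_R(M)$ is the kernel term in an exact sequence $0\to\Omega^n_R(M)\to P_{n-1}\to\cdots\to P_0\to M\to 0$ with all $P_i$ finitely generated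 projective over $R$ ($\Omega^0_R(M)=M$); it is unique up to projective summands. $A$-modules are regarded as $R$-modules via $\varphi$. $\operatorname{Ext}^n_R(A,R)$ is an $A$-$R$-bimodule: the left $A$-action comes from the right multiplication of $A$ on the first argument, the right $R$-action from the right multiplication of $R$ on the second argument. *)

(* Defs.v *)
From HB Require Import structures.
From mathcomp Require Import all_boot all_order all_algebra.
From mathcomp Require Import boolp.

Set Implicit Arguments.
Unset Strict Implicit.
Unset Printing Implicit Defensive.

Import GRing.Theory.
Local Open Scope ring_scope.

(* Left R-modules are [lmodType R]; right R-modules are [lmodType R^c], where
   R^c is the converse ring: v.r is written [r *: v]. Rings are [pzRingType],
   so that the zero ring is allowed. *)

Section FiniteGeneration.
Variables (R : pzRingType) (V : lmodType R).

Definition is_submodule (S : V -> Prop) : Prop :=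
  S 0 /\ forall (r : R) (x y : V), S x -> S y -> S (r *: x + y).

Definition fg_submodule (S : V -> Prop) : Prop :=
  exists (m : nat) (s : 'I_m -> V), (forall i, S (s i)) /\
    forall x, S x -> exists c : 'I_m -> R, x = \sum_(i < m) c i *: s i.

Definition fg_module : Prop := fg_submodule (fun=> True).

Definition noetherian_module : Prop :=
  forall S : V -> Prop, is_submodule S -> fg_submodule S.

Definition trivial_module : Prop := forall x : V, x = 0.

End FiniteGeneration.

Definition noetherian_ring (R : pzRingType) : Prop :=
  noetherian_module (R^o : lmodType R) /\
  noetherian_module ((R^c)^o : lmodType R^c).

Definition restr (R A : pzRingType) (phi : {rmorphism R -> A})
  (M : lmodType A) : Type := M.

Section RestrictionOfScalars.
Variables (R A : pzRingType) (phi : {rmorphism R -> A}).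

Section Restr.
Variable M : lmodType A.
HB.instance Definition _ := GRing.Zmodule.on (restr phi M).
Definition restr_scale (r : R) (x : restr phi M) : restr phi M := phi r *: (x : M).
Fact restr_scaleA a b x :
  restr_scale a (restr_scale b x) = restr_scale (a * b) x.
Proof. by rewrite /restr_scale scalerA rmorphM. Qed.
Fact restr_scale1 : left_id 1 restr_scale.
Proof. by move=> x; rewrite /restr_scale rmorph1 scale1r. Qed.
Fact restr_scaleDr : right_distributive restr_scale +%R.
Proof. by move=> a x y; rewrite /restr_scale scalerDr. Qed.
Fact restr_scaleDl x : {morph restr_scale^~ x : a b / a + b}.
Proof. by move=> a b; rewrite /restr_scale rmorphD scalerDl. Qed.
HB.instance Definition _ := GRing.Zmodule_isLmodule.Build R (restr phi M)
  restr_scaleA restr_scale1 restr_scaleDr restr_scaleDl.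
End Restr.

(* phi as a ring homomorphism R^c -> A^c. *)
Definition conv_fun (r : R^c) : A^c := phi r.
Fact conv_fun_is_zmod : zmod_morphism conv_fun.
Proof. exact: rmorphB phi. Qed.
Fact conv_fun_is_monoid : monoid_morphism conv_fun.
Proof. by split=> [|x y]; [exact: rmorph1 phi | exact: rmorphM phi _ _]. Qed.
HB.instance Definition _ :=
  GRing.isZmodMorphism.Build R^c A^c conv_fun conv_fun_is_zmod.
HB.instance Definition _ :=
  GRing.isMonoidMorphism.Build R^c A^c conv_fun conv_fun_is_monoid.
Definition conv_morph : {rmorphism R^c -> A^c} :=
  GRing.RMorphism.clone R^c A^c conv_fun _.

End RestrictionOfScalars.

Definition finite_morphism (R A : pzRingType) (phi : {rmorphism R -> A}) :=
  fg_module (restr phi A^o : lmodType R) /\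
  fg_module (restr (conv_morph phi) (A^c)^o : lmodType R^c).

(* Hom_R(M, R), a right R-module by (f.r)(x) = f(x) r. *)
Definition dual (R : pzRingType) (M : lmodType R) : Type :=
  {linear M -> R^o}.

Section Dual.
Variables (R : pzRingType) (M : lmodType R).
Implicit Types f g : dual M.

Definition dual_fun f : M -> R := (f : {linear M -> R^o}).

Lemma dualP f g : dual_fun f =1 dual_fun g -> f = g.
Proof.
case: f g => f [[f1] [f2]] [g [[g1] [g2]]] /funext; rewrite /dual_fun /= => e.
move: f1 f2; rewrite e => f1 f2.
by rewrite (Prop_irrelevance f1 g1) (Prop_irrelevance f2 g2).
Qed.

HB.instance Definition _ := gen_eqMixin (dual M).
HB.instance Definition _ := gen_choiceMixin (dual M).

Section Mk.
Variables (h : M -> R^o) (hl : linear h).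
HB.instance Definition _ := GRing.isLinear.Build R M R^o _ h hl.
Definition mk_dual : dual M := h : {linear M -> R^o}.
End Mk.

Fact dual0_linear : linear ((fun=> 0) : M -> R^o).
Proof. by move=> a x y; rewrite scaler0 addr0. Qed.
Definition dual0 := mk_dual dual0_linear.

Fact dualN_linear f : linear ((fun x => - f x) : M -> R^o).
Proof. by move=> a x y; rewrite linearP opprD scalerN. Qed.
Definition dualN f := mk_dual (dualN_linear f).

Fact dualD_linear f g : linear ((fun x => f x + g x) : M -> R^o).
Proof. by move=> a x y; rewrite !linearP scalerDr addrACA. Qed.
Definition dualD f g := mk_dual (dualD_linear f g).

Fact dualZ_linear (r : R^c) f :
  linear ((fun x => dual_fun f x * (r : R)) : M -> R^o).
Proof.
move=> a x y; rewrite /dual_fun linearP mulrDl; congr (_ + _).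
exact/esym/mulrA.
Qed.
Definition dualZ r f := mk_dual (dualZ_linear r f).

Fact dualDA : associative dualD.
Proof. by move=> f g h; apply: dualP => x; apply: addrA. Qed.
Fact dualDC : commutative dualD.
Proof. by move=> f g; apply: dualP => x; apply: addrC. Qed.
Fact dual0D : left_id dual0 dualD.
Proof. by move=> f; apply: dualP => x; apply: add0r. Qed.
Fact dualND : left_inverse dual0 dualN dualD.
Proof. by move=> f; apply: dualP => x; apply: addNr. Qed.
HB.instance Definition _ :=
  GRing.isZmodule.Build (dual M) dualDA dualDC dual0D dualND.

Fact dualZA (a b : R^c) f : dualZ a (dualZ b f) = dualZ (a * b) f.
Proof. by apply: dualP => x; rewrite /dual_fun /= -mulrA. Qed.
Fact dualZ1 : left_id (1 : R^c) dualZ.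
Proof. by move=> f; apply: dualP => x; apply: mulr1. Qed.
Fact dualZDr : right_distributive dualZ +%R.
Proof. by move=> a f g; apply: dualP => x; apply: mulrDl. Qed.
Fact dualZDl f : {morph dualZ^~ f : a b / a + b}.
Proof. by move=> a b; apply: dualP => x; apply: mulrDr. Qed.
HB.instance Definition _ := GRing.Zmodule_isLmodule.Build R^c (dual M)
  dualZA dualZ1 dualZDr dualZDl.

End Dual.

Section DualMap.
Variables (R : pzRingType) (M N : lmodType R) (u : {linear M -> N}).

Fact dual_map_fun_linear (f : dual N) :
  linear ((fun x => dual_fun f (u x)) : M -> R^o).
Proof. by move=> a x y; rewrite /dual_fun !linearP. Qed.
Definition dual_map (f : dual N) : dual M := mk_dual (dual_map_fun_linear f).
Fact dual_map_linear : linear dual_map.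
Proof. by move=> a f g; apply: dualP. Qed.
HB.instance Definition _ :=
  GRing.isLinear.Build R^c (dual N) (dual M) _ dual_map dual_map_linear.
End DualMap.

Definition surj (X Y : Type) (f : X -> Y) : Prop :=
  forall y, exists x, f x = y.

Definition exact (U V W : zmodType) (f : U -> V) (g : V -> W) : Prop :=
  forall y, g y = 0 <-> exists x, f x = y.

Definition short_exact (U V W : zmodType) (f : U -> V) (g : V -> W) : Prop :=
  [/\ injective f, exact f g & surj g].

Section ModuleNotions.
Variable R : pzRingType.

Definition isomorphic (U V : lmodType R) : Prop :=
  exists f : {linear U -> V}, bijective f.

Definition projective (P : lmodType R) : Prop :=
  forall (U V : lmodType R) (g : {linear U -> V}) (f : {linear P -> V}),
    surj g -> exists h : {linear P -> U}, forall x, g (h x) = f x.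

(* An exact sequence ... -> X_2 -> X_1 -> X_0 -> M -> 0. *)
Record resolution (M : lmodType R) := Resolution {
  res_term :> nat -> lmodType R;
  res_diff : forall i, {linear res_term i.+1 -> res_term i};
  res_aug : {linear res_term 0 -> M};
  res_aug_surj : surj res_aug;
  res_exact0 : exact (res_diff 0) res_aug;
  res_exact : forall i, exact (res_diff i.+1) (res_diff i)
}.

Definition projective_resolution (M : lmodType R) (X : resolution M) : Prop :=
  forall i, projective (X i).

(* k ranges over the integers: for k = -1 all the terms vanish, so that this
   says that M is the zero module. *)
Definition pd_le (k : int) (M : lmodType R) : Prop :=
  exists X : resolution M, projective_resolution X /\
    forall i : nat, k < i%:Z -> trivial_module (X i).

(* The complex is indexed by int, with d i : C_(i+1) -> C_i; all its terms are
   of the form C_(i+1), so that the two exactness conditions cover every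
   degree. *)
Definition gorenstein_projective (M : lmodType R) : Prop :=
  exists (C : int -> lmodType R) (d : forall i : int, {linear C (i + 1) -> C i}),
    [/\ forall i, projective (C i),
        forall i, exact (d (i + 1)) (d i),
        forall Q : lmodType R, projective Q ->
          forall (i : int) (f : {linear C (i + 1) -> Q}),
            (forall x, f (d (i + 1) x) = 0) <->
            exists g : {linear C i -> Q}, forall x, f x = g (d i x)
      & exists (i : int) (j : {linear M -> C i}), injective j /\
          forall y, (exists m, j m = y) <-> exists x, d i x = y].

Definition finite_gpd (M : lmodType R) : Prop :=
  exists (m : nat) (X : resolution M),
    (forall i, (i <= m)%N -> gorenstein_projective (X i)) /\
    (forall i, (m < i)%N -> trivial_module (X i)).

(* 0 -> X_n -> X_(n-1) -> ... -> X_0 -> M -> 0 is exact, X_i is finitely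
   generated projective for i < n, and S is X_n; for n = 0, S is M. *)
Definition is_syzygy (n : nat) (M S : lmodType R) : Prop :=
  exists X : resolution M,
    [/\ forall i, (i < n)%N -> fg_module (X i) /\ projective (X i),
        forall i, (n < i)%N -> trivial_module (X i)
      & isomorphic S (X n)].

(* T is a cokernel of Hom_R(f, R) for a presentation G1 -f-> G0 -> M -> 0 by
   finitely generated modules of the class C. *)
Definition is_transpose_wrt (C : lmodType R -> Prop)
    (M : lmodType R) (T : lmodType R^c) : Prop :=
  exists (G1 G0 : lmodType R) (f : {linear G1 -> G0}) (p : {linear G0 -> M})
         (q : {linear dual G1 -> T}),
    [/\ fg_module G1 /\ C G1, fg_module G0 /\ C G0,
        exact f p /\ surj p & exact (dual_map f) q /\ surj q].

Definition is_transpose := is_transpose_wrt projective.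
Definition is_gorenstein_transpose := is_transpose_wrt gorenstein_projective.

Section Cohomology.
Variables (M : lmodType R) (P : resolution M).

Definition cocycle (n : nat) (z : dual (P n)) : Prop :=
  dual_map (res_diff P n) z = 0.

Definition coboundary (n : nat) : dual (P n) -> Prop :=
  match n with
  | 0%N => fun z => z = 0
  | m.+1 => fun z => exists y : dual (P m), z = dual_map (res_diff P m) y
  end.

End Cohomology.

(* Ext^n_R(M, R) = 0 *)
Definition ext_vanishes (n : nat) (M : lmodType R) : Prop :=
  exists P : resolution M, projective_resolution P /\
    forall z : dual (P n), cocycle z -> coboundary z.

End ModuleNotions.

Section Bimodules.
Variables (A R : pzRingType).

Record bimodule := Bimodule {
  bimod_right :> lmodType R^c;
  lact : A -> bimod_right -> bimod_right;
  lact1 : forall x, lact 1 x = x;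
  lactA : forall a b x, lact a (lact b x) = lact (a * b) x;
  lactDl : forall a b x, lact (a + b) x = lact a x + lact b x;
  lact_linear : forall a (r : R^c) x y,
    lact a (r *: x + y) = r *: lact a x + lact a y
}.

Definition balanced (T : lmodType A^c) (E : bimodule) (Z : zmodType)
    (b : T -> E -> Z) : Prop :=
  [/\ forall t t' e, b (t + t') e = b t e + b t' e,
      forall t e e', b t (e + e') = b t e + b t e'
    & forall (a : A) t e, b ((a : A^c) *: t) e = b t (lact a e)].

(* X is the tensor product of T and E over A, as a right R-module. *)
Definition is_tensor (T : lmodType A^c) (E : bimodule) (X : lmodType R^c)
    (tau : T -> E -> X) : Prop :=
  [/\ balanced tau,
      forall (r : R^c) t e, tau t (r *: e) = r *: tau t e
    & forall (Z : zmodType) (b : T -> E -> Z), balanced b ->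
        exists h : {additive X -> Z}, (forall t e, h (tau t e) = b t e) /\
          forall h' : {additive X -> Z},
            (forall t e, h' (tau t e) = b t e) -> h' =1 h].

End Bimodules.

(* E is the A-R-bimodule Ext^n_R(A, R): cls sends an n-cocycle of Hom_R(P, R) to
   its class, and a in A acts through any chain map alpha lifting the
   endomorphism x |-> x * a of the left R-module A. The values of cls outside
   the cocycles are irrelevant. *)
Definition is_ext_bimodule (R A : pzRingType) (phi : {rmorphism R -> A})
    (n : nat) (E : bimodule A R) : Prop :=
  exists (P : resolution (restr phi A^o)) (cls : dual (P n) -> E),
    projective_resolution P /\
    [/\ forall (r : R^c) z w, cocycle z -> cocycle w ->
          cls (r *: z + w) = r *: cls z + cls w,
        forall e, exists z, cocycle z /\ cls z = e,
        forall z, cocycle z -> (cls z = 0 <-> coboundary z)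
      & forall (a : A) (alpha : forall i, {linear P i -> P i}),
          (forall x, (res_aug P (alpha 0%N x) : A) = (res_aug P x : A) * a) ->
          (forall i x,
             res_diff P i (alpha i.+1 x) = alpha i (res_diff P i x)) ->
          forall z, cocycle z -> lact a (cls z) = cls (dual_map (alpha n) z)].

(* Main.v *)
From HB Require Import structures.
From mathcomp Require Import all_boot all_order all_algebra.
From mathcomp Require Import boolp functions ring_quotient generic_quotient.
Require Import Defs.

(** Let f : L1 -> L0 be the presentation of M over A whose dual defines T, with
    image Z and kernel K, and let Y1, Y2, Y3 be resolutions of K, Z, M over R by
    finitely generated projectives. The horseshoe lemma makes Y1 x Y2 and Y2 x Y3
    into resolutions of L1 and L0, and the projection to Y2 lifts f. The cokernels
    G1, G0, S of the differentials in degree n are n-th syzygies of L1, L0, M, and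
    G1 -> G0 -> S -> 0 is exact. Three facts then give the theorem.

    The modules G1 and G0 are Gorenstein projective (gp_syz), so that the cokernel G
    of the dual of G1 -> G0 is a Gorenstein transpose of S. Finite Gorenstein
    projective dimension of A yields a hull: an embedding into a module of finite
    projective dimension with Gorenstein projective cokernel (finite_gpd_hull).
    Hulls pass to finite sums and to syzygies (hull_prod, hull_syzygy). An n-th
    syzygy of a free A-module of finite rank has no Ext into R, hence none into any
    projective module (ext_zero_coef); for such a module the middle term of the hull
    is projective, and then the module is Gorenstein projective (hull_perp_gp). The
    passage to summands of free modules is gp_summand. The closure properties of
    Gorenstein projectives rest on a coinduction principle (gp_coind), which
    reduces the construction of a complete resolution to one step to the right.

    The dual of G1 is the module of n-cocycles of Y1 x Y2 with values in R, and
    its quotient by the coboundaries and the cocycles that come from L0 is the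
    cokernel of Ext^n(L0, R) -> Ext^n(L1, R), which is the tensor product
    (tensor_cocycles). The map from the cocycles to the tensor product is explicit:
    a dual basis of L1 writes the identity of L1 as a sum of maps through A, and
    the cocycle is pulled back along lifts of these maps. This gives the surjection
    from G to X.

    Its kernel consists of the classes of coboundaries. It is isomorphic to the
    module of coboundaries in degree n on the resolution Y1 of K, and it is resolved
    by the duals of the terms Y1_(n-1), ..., Y1_0 (pd_transpose_kernel,
    pd_cocycles), because Ext^i_R(K, R) = 0 for i < n. The latter holds for every
    finitely generated A-module by dimension shifting from A (ext_zero_restr). *)

Set Implicit Arguments.
Unset Strict Implicit.
Unset Printing Implicit Defensive.

Import GRing.Theory.
Local Open Scope ring_scope.

(** * Linear maps, submodules and quotients *)

Section LinearFunction.
Variables (R : pzRingType) (U V : lmodType R) (h : U -> V) (hl : linear h).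
HB.instance Definition _ := GRing.isLinear.Build R U V _ h hl.
Definition linear_of : {linear U -> V} := h.
End LinearFunction.

Section SubmodulesAndQuotients.
Variables (R : pzRingType) (V : lmodType R).

Section Submodule.
Variables (S : V -> Prop) (hS : is_submodule S).
Definition submod_pred of is_submodule S : {pred V} := fun x => `[< S x >].
Local Notation S' := (submod_pred hS).
Fact submod_pred_closed : submod_closed S'.
Proof.
split=> [|a x y]; first by apply/asboolP; case: hS.
by move=> /asboolP Sx /asboolP Sy; apply/asboolP; apply: hS.2.
Qed.
HB.instance Definition _ := GRing.isSubmodClosed.Build R V S'
  submod_pred_closed.
Record submod : Type := Submod { submod_val : V; _ : submod_val \in S' }.
HB.instance Definition _ := [isSub for submod_val].
HB.instance Definition _ := [Choice of submod by <:].
HB.instance Definition _ := [SubChoice_isSubLmodule of submod by <:].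
End Submodule.

(** Submodules and quotients are only used through their universal maps. *)
Lemma sub_ex (S : V -> Prop) : is_submodule S ->
  exists (K : lmodType R) (i : {linear K -> V}),
    injective i /\ forall x, S x <-> exists k, i k = x.
Proof.
move=> hS; exists (submod hS : lmodType R), (\val : {linear submod hS -> V}).
split=> [|x]; first exact: val_inj.
split=> [Sx|[k <-]]; last by apply/asboolP; exact: (valP k).
have Sx' : x \in submod_pred hS by apply/asboolP.
by exists (Submod Sx').
Qed.

Section Quotient.
Variables (S : V -> Prop) (hS : is_submodule S).

Definition quomod : Type := Quotient.quot (submod_pred hS).
HB.instance Definition _ := GRing.Zmodule.on quomod.
HB.instance Definition _ := EqQuotient.on quomod.

Local Notation pq := (\pi_(quomod)%qT : V -> quomod).

Let piP (x y : V) : pq x = pq y <-> S (x - y).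
Proof.
split=> [/eqP|h]; first by rewrite -Quotient.idealrBE => /asboolP.
by apply/eqP; rewrite -Quotient.idealrBE; apply/asboolP.
Qed.

Let pi_add (x y : V) : pq (x + y) = pq x + pq y.
Proof. exact: (raddfD (\pi_(quomod)%qT : {additive V -> quomod})). Qed.

Definition quomod_scale (a : R) (x : quomod) : quomod := pq (a *: repr x).
Let scale_pi a (x : V) : quomod_scale a (pq x) = pq (a *: x).
Proof.
apply/piP; rewrite -scalerBr -[a *: _]addr0.
apply: hS.2; last by have [] := hS.
by apply/piP; exact: reprK.
Qed.
Let pq_surj (x : quomod) : exists v, pq v = x.
Proof. by exists (repr x); exact: reprK. Qed.
Fact quomod_scaleA a b x :
  quomod_scale a (quomod_scale b x) = quomod_scale (a * b) x.
Proof. by have [v <-] := pq_surj x; rewrite !scale_pi scalerA. Qed.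
Fact quomod_scale1 : left_id 1 quomod_scale.
Proof. by move=> x; have [v <-] := pq_surj x; rewrite scale_pi scale1r. Qed.
Fact quomod_scaleDr : right_distributive quomod_scale +%R.
Proof.
move=> a x y; have [v <-] := pq_surj x; have [w <-] := pq_surj y.
by rewrite -pi_add !scale_pi scalerDr pi_add.
Qed.
Fact quomod_scaleDl x : {morph quomod_scale^~ x : a b / a + b}.
Proof.
by move=> a b; have [v <-] := pq_surj x; rewrite !scale_pi scalerDl pi_add.
Qed.
HB.instance Definition _ := GRing.Zmodule_isLmodule.Build R quomod
  quomod_scaleA quomod_scale1 quomod_scaleDr quomod_scaleDl.

Fact quomod_pi_linear : linear pq.
Proof. by move=> a x y; rewrite pi_add -scale_pi. Qed.

Lemma quo_ex : exists (Q : lmodType R) (p : {linear V -> Q}),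
  surj p /\ forall x, p x = 0 <-> S x.
Proof.
exists (quomod : lmodType R), (linear_of quomod_pi_linear).
split=> [y|x]; first exact: pq_surj.
have e0 : linear_of quomod_pi_linear 0 = 0 by exact: linear0.
by have := piP x 0; rewrite subr0 => <-; rewrite -e0.
Qed.
End Quotient.
End SubmodulesAndQuotients.

Section FactoringLinearMaps.
Variable R : pzRingType.
Implicit Types U V W P : lmodType R.

Lemma inj0P U V (f : {linear U -> V}) :
  injective f <-> forall x, f x = 0 -> x = 0.
Proof.
split=> [fI x fx0|f0 x y fxy]; first by apply: fI; rewrite linear0.
by apply/eqP; rewrite -subr_eq0; apply/eqP/f0; rewrite linearB fxy subrr.
Qed.

Lemma factor_surj U V W (p : {linear U -> V}) (f : {linear U -> W}) :
  surj p -> (forall x, p x = 0 -> f x = 0) ->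
  exists g : {linear V -> W}, forall x, g (p x) = f x.
Proof.
move=> ps pf; have [s sP] := choice ps.
have sf x : f (s (p x)) = f x.
  by apply/eqP; rewrite -subr_eq0 -linearB pf // linearB sP subrr.
have gl : linear (fun y => f (s y)).
  by move=> a y z; rewrite -{1}(sP y) -{1}(sP z) -linearP sf linearP.
by exists (linear_of gl).
Qed.

Lemma factor_inj U V W (j : {linear V -> W}) (f : {linear U -> W}) :
  injective j -> (forall x, exists y, j y = f x) ->
  exists g : {linear U -> V}, forall x, j (g x) = f x.
Proof.
move=> jI jf; have [s sP] := choice jf.
have gl : linear s by move=> a x y; apply: jI; rewrite linearP !sP linearP.
by exists (linear_of gl).
Qed.

Lemma inverse_ex U V (f : {linear U -> V}) : injective f -> surj f ->
  exists g : {linear V -> U}, cancel f g /\ cancel g f.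
Proof.
move=> fI fs; have [|g gP] := @factor_inj _ _ _ f (idfun : {linear V -> V}) fI.
  by move=> x; have [y] := fs x; exists y.
by exists g; split=> // x; apply: fI; rewrite gP.
Qed.

Lemma kernel_ex U V (f : {linear U -> V}) :
  exists (K : lmodType R) (i : {linear K -> U}), injective i /\ exact i f.
Proof.
have [|K [i [iI iP]]] := @sub_ex R U (fun x => f x = 0).
  by split=> [|a x y fx fy]; rewrite ?linear0 // linearP fx fy scaler0 addr0.
by exists K, i.
Qed.

Definition imgp U V (f : {linear U -> V}) y := exists x, f x = y.

Lemma img_submodule U V (f : {linear U -> V}) : is_submodule (imgp f).
Proof.
split=> [|a _ _ [x <-] [y <-]]; first by exists 0; rewrite linear0.
by exists (a *: x + y); rewrite linearP.
Qed.

Lemma coker_ex U V (f : {linear U -> V}) :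
  exists (Q : lmodType R) (p : {linear V -> Q}), surj p /\ exact f p.
Proof. by have [Q [p []]] := quo_ex (img_submodule f); exists Q, p. Qed.

Lemma image_ex U V (f : {linear U -> V}) :
  exists (I : lmodType R) (p : {linear U -> I}) (i : {linear I -> V}),
    [/\ surj p, injective i & forall x, i (p x) = f x].
Proof.
have [I [i [iI iP]]] := sub_ex (img_submodule f).
have [|p pP] := @factor_inj _ _ _ i f iI.
  by move=> x; apply/iP; exists x.
exists I, p, i; split=> // y; have /iP[x fx] : exists k, i k = i y by exists y.
by exists x; apply: iI; rewrite pP.
Qed.

(** The test surjection of the definition of projectivity is replaced by a map
    whose image contains that of f, as g is surjective onto its image. *)
Lemma proj_lift P U V (g : {linear U -> V}) (f : {linear P -> V}) :
  projective P -> (forall x, exists y, g y = f x) ->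
  exists h : {linear P -> U}, forall x, g (h x) = f x.
Proof.
move=> Pp gf; have [I [p [i [ps iI ip]]]] := image_ex g.
have [|f' f'P] := @factor_inj _ _ _ i f iI.
  by move=> x; have [y <-] := gf x; exists (p y).
have [h hP] := Pp _ _ p f' ps.
by exists h => x; rewrite -ip hP.
Qed.

Lemma proj_lift_exact P U V W (g : {linear U -> V}) (k : {linear V -> W})
    (f : {linear P -> V}) :
  projective P -> exact g k -> (forall x, k (f x) = 0) ->
  exists h : {linear P -> U}, forall x, g (h x) = f x.
Proof. by move=> Pp gk kf; apply: proj_lift => // x; apply/gk. Qed.

End FactoringLinearMaps.

(** * Projective and finitely generated modules *)

Section Projective.
Variable R : pzRingType.
Implicit Types U V W P Q : lmodType R.

Definition zero_mod : lmodType R := 'rV[R]_0.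

Lemma zero_mod_trivial : trivial_module zero_mod.
Proof. by move=> x; apply/rowP; case. Qed.

Lemma trivial_projective P : trivial_module P -> projective P.
Proof.
move=> P0 U V g f _; exists \0 => x /=.
by rewrite (P0 x) !linear0.
Qed.

Lemma projective_retract P Q (i : {linear P -> Q}) (r : {linear Q -> P}) :
  cancel i r -> projective Q -> projective P.
Proof.
move=> ir Pq U V g f gs; have [h hP] := Pq _ _ g (f \o r) gs.
by exists (h \o i) => x /=; rewrite hP /= ir.
Qed.

Fact inl_linear U V : linear (fun x : U => (x, 0) : (U * V)%type).
Proof. by move=> a x y; rewrite -[RHS]/(_, _) /= scaler0 addr0. Qed.
Definition inl_lin U V : {linear U -> (U * V)%type} :=
  linear_of (@inl_linear U V).

Fact inr_linear U V : linear (fun y : V => (0, y) : (U * V)%type).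
Proof. by move=> a x y; rewrite -[RHS]/(_, _) /= scaler0 addr0. Qed.
Definition inr_lin U V : {linear V -> (U * V)%type} :=
  linear_of (@inr_linear U V).

Lemma pair_split U V (x : U) (y : V) : (x, y) = inl_lin U V x + inr_lin U V y.
Proof. by rewrite -[RHS]/(_, _) /= addr0 add0r. Qed.

Lemma projective_prod P Q : projective P -> projective Q ->
  projective (P * Q)%type.
Proof.
move=> Pp Pq U V g f gs.
have [h1 h1P] := Pp _ _ g (f \o inl_lin P Q) gs.
have [h2 h2P] := Pq _ _ g (f \o inr_lin P Q) gs.
exists ((h1 \o fst) \+ (h2 \o snd)) => -[x y] /=.
by rewrite linearD h1P h2P /= -linearD [in RHS]pair_split.
Qed.

Lemma linear_sum_ex U V n (f : 'I_n -> {linear U -> V}) :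
  exists g : {linear U -> V}, forall x, g x = \sum_i f i x.
Proof.
have gl : linear (fun x => \sum_i f i x).
  move=> a x y; rewrite scaler_sumr -big_split.
  by apply: eq_bigr => i _; rewrite linearP.
by exists (linear_of gl).
Qed.

Lemma row_comb_ex V n (v : 'I_n -> V) :
  exists g : {linear 'rV[R]_n -> V}, forall x, g x = \sum_i x 0 i *: v i.
Proof.
have gl : linear (fun x : 'rV[R]_n => \sum_i x 0 i *: v i).
  move=> a x y; rewrite scaler_sumr -big_split.
  by apply: eq_bigr => i _; rewrite !mxE scalerDl scalerA.
by exists (linear_of gl).
Qed.

Lemma row_sum_delta_sc n (x : 'rV[R]_n) : x = \sum_i x 0 i *: delta_mx 0 i.
Proof. exact: row_sum_delta. Qed.

Lemma projective_row n : projective ('rV[R]_n : lmodType R).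
Proof.
move=> U V g f gs; have [s sP] := choice gs.
have [h hP] := row_comb_ex (fun i => s (f (delta_mx 0 i))).
exists h => x; rewrite hP linear_sum [in RHS](row_sum_delta_sc x) linear_sum.
by apply: eq_bigr => i _; rewrite !linearZ sP.
Qed.

Lemma fg_row n : fg_module ('rV[R]_n : lmodType R).
Proof.
exists n, (delta_mx 0); split=> // x _; exists (x 0); exact: row_sum_delta_sc.
Qed.

Lemma fg_surj U V (p : {linear U -> V}) :
  surj p -> fg_module U -> fg_module V.
Proof.
move=> ps [n [s [_ sP]]]; exists n, (fun i => p (s i)); split=> // y _.
have [x <-] := ps y; have [c ->] := sP x I; exists c.
by rewrite linear_sum; apply: eq_bigr => i _; rewrite linearZ.
Qed.

Lemma fg_cover V : fg_module V ->
  exists n (p : {linear 'rV[R]_n -> V}), surj p.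
Proof.
move=> [n [s [_ sP]]]; have [p pP] := row_comb_ex s; exists n, p => y.
have [c ->] := sP y I; exists (\row_i c i).
by rewrite pP; apply: eq_bigr => i _; rewrite mxE.
Qed.

Lemma dual_basis P : fg_module P -> projective P ->
  exists n (x : 'I_n -> P) (u : 'I_n -> {linear P -> R^o}),
    forall y, y = \sum_i (u i y : R) *: x i.
Proof.
move=> fP Pp; have [n [p ps]] := fg_cover fP.
have [h hP] := Pp _ _ p idfun ps.
have ul i : linear (fun y => h y 0 i : R^o).
  by move=> a y z; rewrite linearP !mxE.
exists n, (fun i => p (delta_mx 0 i)), (fun i => linear_of (ul i)) => y.
have yE : p (h y) = y := hP y.
rewrite -{1}yE [h y in LHS]row_sum_delta_sc linear_sum.
by apply: eq_bigr => i _; rewrite linearZ.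
Qed.

End Projective.

Section Noetherian.
Variables (R : pzRingType) (V : lmodType R).

(** Being a linear combination of the entries of a list, in a form that suits
    induction on the list. *)
Fixpoint span (s : seq V) (x : V) : Prop :=
  if s is v :: s' then exists r : R, span s' (x - r *: v) else x = 0.

Lemma span_comb n (f : 'I_n -> V) x :
  span [seq f i | i <- enum 'I_n] x <->
  exists c : 'I_n -> R, x = \sum_i c i *: f i.
Proof.
elim: n f x => [|n IHn] f x.
  rewrite enum_ord0 /=; split=> [->|[c ->]]; last by rewrite big_ord0.
  by exists (fun=> 0); rewrite big_ord0.
rewrite enum_ordSl /= -map_comp; split=> [[r]|[c ->]].
  move=> /IHn[c xE]; exists (fun i => oapp c r (unlift ord0 i)).
  rewrite big_ord_recl unlift_none /=; apply/eqP; rewrite addrC -subr_eq xE; apply/eqP.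
  by apply: eq_bigr => i _; rewrite liftK.
exists (c ord0); apply/IHn; exists (fun i => c (lift ord0 i)).
by rewrite big_ord_recl /= addrC addKr.
Qed.

Lemma fg_spanP (S : V -> Prop) :
  fg_submodule S <-> exists s : seq V,
    (forall x, x \in s -> S x) /\ forall x, S x -> span s x.
Proof.
split=> [[m [f [fS fP]]]|[s [sS sP]]].
  exists [seq f i | i <- enum 'I_m]; split=> [x /mapP[i _ ->] //|x /fP].
  by move/span_comb.
exists (size s), (tnth (in_tuple s)); split=> [i|x /sP].
  by apply: sS; apply: mem_tnth.
have {1}-> : s = [seq tnth (in_tuple s) i | i <- enum 'I_(size s)].
  exact: (esym (map_tnth_enum (in_tuple s))).
by move/span_comb.
Qed.

Lemma span_lin s a x y : span s x -> span s y -> span s (a *: x + y).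
Proof.
elim: s x y => [|v s IHs] x y /=; first by move=> -> ->; rewrite scaler0 addr0.
move=> [r xr] [t yt]; exists (a * r + t).
have := IHs _ _ xr yt; congr span.
by rewrite scalerBr scalerDl scalerA opprD addrACA.
Qed.

Lemma span0 s : span s 0.
Proof. by elim: s => //= v s IHs; exists 0; rewrite scale0r subr0. Qed.

Lemma span_cat s t x y : span s x -> span t y -> span (s ++ t) (x + y).
Proof.
elim: s x => [|v s IHs] x /=; first by move=> ->; rewrite add0r.
by move=> [r xr] yt; exists r; rewrite addrAC; apply: IHs.
Qed.

(** In a submodule of the span of v :: s, the coefficients of v form a left
    ideal; lifts of generators of this ideal and generators of the part that
    lies in the span of s generate together. *)
Lemma noetherian_fg : noetherian_module (R^o : lmodType R) ->
  fg_module V -> noetherian_module V.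
Proof.
move=> hR /fg_spanP[s [_ sP]] S hS.
have {sP} sP x : S x -> span s x by move=> _; apply: sP.
elim: s S hS sP => [|v s IHs] S hS sP.
  by apply/fg_spanP; exists [::]; split.
have [S0 Slin] := hS.
pose I (r : R^o) := exists x, S x /\ span s (x - (r : R) *: v).
have hI : is_submodule I.
  split; first by exists 0; rewrite scale0r subr0; split=> //; apply: span0.
  move=> a r t [x [Sx xr]] [y [Sy yt]]; exists (a *: x + y); split.
    exact: Slin.
  have := span_lin a xr yt; congr span.
  by rewrite scalerBr scalerDl scalerA opprD addrACA.
have [m [f [fI fP]]] := hR _ hI.
have [x xP] := choice fI.
have hS' : is_submodule (fun y => S y /\ span s y).
  split=> [|a y z [Sy ys] [Sz zs]]; first by split=> //; apply: span0.
  by split; [apply: Slin | apply: span_lin].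
have /fg_spanP[t [tS tP]] := IHs _ hS' (fun y => @proj2 _ _).
have sumS c : S (\sum_i c i *: x i).
  by apply: big_ind => // [y z Sy Sz|i _];
    [rewrite -[y]scale1r; apply: Slin
    |rewrite -[_ *: _]addr0; apply: Slin => //; case: (xP i)].
apply/fg_spanP; exists ([seq x i | i <- enum 'I_m] ++ t); split.
  by move=> y; rewrite mem_cat => /orP[/mapP[i _ ->]|/tS[] //]; case: (xP i).
move=> y Sy; have [r yr] := sP y Sy.
have [|c rE] := fP r; first by exists y.
rewrite -[y](subrK (\sum_i c i *: x i)) addrC; apply: span_cat.
  by apply/span_comb; exists c.
apply: tP; split; first by rewrite addrC -scaleN1r; apply: Slin.
have -> : y - \sum_i c i *: x i =
    (-1) *: (\sum_i c i *: (x i - (f i : R) *: v)) + (y - r *: v).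
  rewrite rE scaler_suml scaleN1r.
  rewrite (_ : \sum_i c i *: (_ - _) =
      \sum_i c i *: x i - \sum_i (c i * f i) *: v).
    by rewrite opprB [RHS]addrC addrA; congr (_ - _); apply/esym/subrK.
  by rewrite -sumrB; apply: eq_bigr => i _; rewrite scalerBr scalerA.
apply: span_lin => //; apply: big_ind => [|y' z ys zs|i _]; first exact: span0.
  by rewrite -[y']scale1r; apply: span_lin.
by rewrite -[_ *: _]addr0; apply: span_lin; [case: (xP i) | apply: span0].
Qed.
End Noetherian.

Lemma fg_submod (R : pzRingType) (M N : lmodType R) (j : {linear M -> N}) :
  noetherian_module (R^o : lmodType R) -> injective j -> fg_module N ->
  fg_module M.
Proof.
move=> hR jI fN; have [m [f [fS fP]]] := noetherian_fg hR fN (img_submodule j).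
have [g gP] := choice fS; exists m, g; split=> // x _.
have [|c xE] := fP (j x); first by exists x.
exists c; apply: jI; rewrite xE linear_sum; apply: eq_bigr => i _.
by rewrite linearZ gP.
Qed.

(** * Free modules and enough projectives *)

(** The free module on all elements of V, as the functions from V to R with finite
    support. *)
Section FreeModule.
Variables (R : pzRingType) (V : lmodType R).

Definition finite_support (f : V -> R^o) :=
  exists s : seq V, forall v, v \notin s -> f v = 0.

Lemma finite_support_submodule : is_submodule finite_support.
Proof.
split=> [|a f g [s sP] [t tP]]; first by exists [::].
exists (s ++ t) => v; rewrite mem_cat negb_or => /andP[/sP fv /tP gv].
by rewrite !fctE fv gv scaler0 addr0.
Qed.

Definition free_mod : lmodType R := submod finite_support_submodule.
Definition coef (x : free_mod) (v : V) : R := submod_val x v.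

Lemma coef_linear a x y v : coef (a *: x + y) v = a * coef x v + coef y v.
Proof. by []. Qed.

Lemma coef_supp x :
  exists s : seq V, uniq s /\ forall v, v \notin s -> coef x v = 0.
Proof.
have /asboolP[s sP] := valP x; exists (undup s); split; first exact: undup_uniq.
by move=> v; rewrite mem_undup; apply: sP.
Qed.

Lemma coef_inj x y : coef x =1 coef y -> x = y.
Proof. by move=> /funext e; apply: val_inj. Qed.

Lemma basis_ex (v : V) : exists x : free_mod, forall w, coef x w = (w == v)%:R.
Proof.
have h : (fun w : V => (w == v)%:R : R^o) \in
    submod_pred finite_support_submodule.
  by apply/asboolP; exists [:: v] => w; rewrite inE => /negPf->.
by exists (Submod h).
Qed.

Lemma sum_supp (W : lmodType R) (x : free_mod) (u : V -> W) s t :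
  uniq s -> uniq t -> (forall v, v \notin s -> coef x v = 0) ->
  (forall v, v \notin t -> coef x v = 0) ->
  \sum_(v <- s) coef x v *: u v = \sum_(v <- t) coef x v *: u v.
Proof.
move=> us ut sP tP.
rewrite (bigID (mem t)) [RHS](bigID (mem s)) /=.
rewrite [X in _ + X]big1 => [|v /tP->]; last by rewrite scale0r.
rewrite [X in _ = _ + X]big1 => [|v /sP->]; last by rewrite scale0r.
rewrite [LHS]addr0 [RHS]addr0 -[LHS]big_filter -[RHS]big_filter.
apply: perm_big; apply: uniq_perm.
- exact: filter_uniq.
- exact: filter_uniq.
by move=> v; rewrite !mem_filter andbC.
Qed.

Lemma free_map_ex (W : lmodType R) (u : V -> W) :
  exists h : {linear free_mod -> W}, forall x s, uniq s ->
    (forall v, v \notin s -> coef x v = 0) -> h x = \sum_(v <- s) coef x v *: u v.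
Proof.
have [s sP] := choice coef_supp.
have hl : linear (fun x => \sum_(v <- s x) coef x v *: u v).
  move=> a x y; pose t := undup (s (a *: x + y) ++ s x ++ s y).
  have ut : uniq t by apply: undup_uniq.
  have sub z : {subset s z <= t} -> forall v, v \notin t -> coef z v = 0.
    by move=> st v vt; apply: (sP z).2; apply: contra vt => /st.
  rewrite (sum_supp _ (sP _).1 ut (sP _).2); last first.
    by apply: sub => v; rewrite mem_undup mem_cat => ->.
  rewrite (sum_supp _ (sP x).1 ut (sP _).2); last first.
    by apply: sub => v; rewrite mem_undup !mem_cat => ->; rewrite orbT.
  rewrite (sum_supp _ (sP y).1 ut (sP _).2); last first.
    by apply: sub => v; rewrite mem_undup !mem_cat => ->; rewrite !orbT.
  rewrite scaler_sumr -big_split; apply: eq_bigr => v _.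
  change (coef (a *: x + y) v *: u v =
    a *: (coef x v *: u v) + coef y v *: u v).
  by rewrite coef_linear scalerDl scalerA.
exists (linear_of hl) => x t ut tP /=.
exact: sum_supp (sP x).1 ut (sP x).2 tP.
Qed.

Lemma free_cover : projective free_mod /\
  exists p : {linear free_mod -> V}, surj p /\ forall x s, uniq s ->
    (forall v, v \notin s -> coef x v = 0) -> p x = \sum_(v <- s) coef x v *: v.
Proof.
have [b bP] := choice basis_ex.
have b0 v w : w \notin [:: v] -> coef (b v) w = 0.
  by rewrite inE bP => /negPf->.
split; last first.
  have [p pP] := free_map_ex id; exists p; split=> // v; exists (b v).
  by rewrite (pP _ [:: v]) //; [rewrite big_seq1 bP eqxx scale1r | exact: b0].
move=> U W g f gs; have [s sP] := choice gs.
have [h hP] := free_map_ex (fun v => s (f (b v))); exists h => x.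
have [t [ut tP]] := coef_supp x; rewrite (hP _ _ ut tP) linear_sum.
have {2}-> : x = \sum_(v <- t) coef x v *: b v.
  apply: coef_inj => w.
  have coef_sum r : coef (\sum_(v <- r) coef x v *: b v) w =
      \sum_(v <- r) coef x v * (w == v)%:R.
    elim: r => [|v r IHr]; first by rewrite !big_nil.
    by rewrite !big_cons coef_linear bP IHr.
  rewrite coef_sum; have [wt|wt] := boolP (w \in t).
    rewrite (bigD1_seq w) //= eqxx mulr1 big1 ?addr0 // => v /negPf.
    by rewrite eq_sym => ->; rewrite mulr0.
  rewrite big1_seq ?tP // => v /= vt; case: eqP => [e|]; last by rewrite mulr0.
  by rewrite e vt in wt.
by rewrite linear_sum; apply: eq_bigr => v _; rewrite !linearZ sP.
Qed.

End FreeModule.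

Section EnoughProjectives.
Variable R : pzRingType.

Lemma enough_projectives (V : lmodType R) :
  exists (P : lmodType R) (p : {linear P -> V}), projective P /\ surj p.
Proof. by have [Pp [p [ps _]]] := free_cover V; exists (free_mod V), p. Qed.

(** A dual basis of an arbitrary projective module, in the form needed below:
    an element has only finitely many nonzero coordinates, so the image of a
    finitely generated module only involves finitely many basis elements. *)
Lemma projective_coords (P Q : lmodType R) (z : {linear P -> Q}) :
  fg_module P -> projective Q ->
  exists n (c : 'I_n -> Q) (y : 'I_n -> {linear Q -> R^o}),
    forall x, z x = \sum_i (y i (z x) : R) *: c i.
Proof.
move=> [n [g [_ gP]]] Pq; have [_ [p [ps pP]]] := free_cover Q.
have [h hP] := Pq _ _ p idfun ps.
have yl v : linear (fun q => coef (h q) v : R^o).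
  by move=> a q q'; rewrite linearP coef_linear.
have [s sP] := choice (fun i => coef_supp (h (z (g i)))).
pose t := undup (flatten [seq s i | i <- enum 'I_n]).
exists (size t), (tnth (in_tuple t)),
  (fun i => linear_of (yl (tnth (in_tuple t) i))).
move=> x; have zE : p (h (z x)) = z x := hP (z x).
rewrite -[LHS]zE (pP _ t) ?undup_uniq //.
  by rewrite big_tnth.
move=> v vt; have [c ->] := gP x I; rewrite linear_sum.
change (linear_of (yl v) (\sum_i z (c i *: g i)) = 0).
rewrite linear_sum big1 // => i _; rewrite linearZ linearZ_LR /=.
rewrite (sP i).2 ?mulr0 //.
  exact: scaler0.
apply: contra vt => vs; rewrite mem_undup; apply/flattenP; exists (s i) => //.
by apply: map_f; rewrite mem_enum.
Qed.

End EnoughProjectives.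

(** * Resolutions and the vanishing of Ext *)

Lemma dependent_choice (T : nat -> Type) (Inv : forall i, T i -> Prop)
    (Rel : forall i, T i -> T i.+1 -> Prop) (t0 : T 0) :
  Inv 0 t0 -> (forall i t, Inv i t -> exists t', Inv i.+1 t' /\ Rel i t t') ->
  exists f : forall i, T i,
    f 0 = t0 /\ forall i, Inv i (f i) /\ Rel i (f i) (f i.+1).
Proof.
move=> h0 hS.
pose step i (t : {t | Inv i t}) : {t' | Inv i.+1 t' /\ Rel i (sval t) t'} :=
  cid (hS i (sval t) (svalP t)).
pose F := nat_rect (fun i => {t | Inv i t}) (exist _ t0 h0)
  (fun i t => exist _ (sval (step i t)) (svalP (step i t)).1).
exists (fun i => sval (F i)); split=> // i; split; first exact: svalP.
exact: (svalP (step i (F i))).2.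
Qed.

Section Resolutions.
Variable R : pzRingType.
Implicit Types M N P Q : lmodType R.

Lemma aug_exact M (X : resolution M) : exact (res_diff X 0) (res_aug X).
Proof. exact: res_exact0. Qed.

Arguments aug_exact {M} X.

Lemma diff_exact M (X : resolution M) i :
  exact (res_diff X i.+1) (res_diff X i).
Proof. exact: res_exact. Qed.
Arguments diff_exact {M} X i.

Lemma res_aug0 M (X : resolution M) x : res_aug X (res_diff X 0 x) = 0.
Proof. by apply/(aug_exact X _); exists x. Qed.

Lemma res_diff0 M (X : resolution M) i x :
  res_diff X i (res_diff X i.+1 x) = 0.
Proof. by apply/(diff_exact X _ _); exists x. Qed.

Definition splice_term P (X : nat -> lmodType R) (i : nat) : lmodType R :=
  if i is i'.+1 then X i' else P.

Section Splice.
Variables (M M1 P : lmodType R) (j : {linear M1 -> P}) (p : {linear P -> M}).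
Variables (X : resolution M1) (jp : short_exact j p).

Definition splice_diff i :
    {linear splice_term P X i.+1 -> splice_term P X i} :=
  match i with 0 => j \o res_aug X | i'.+1 => res_diff X i' end.

Fact splice_surj : surj p. Proof. by case: jp. Qed.

Fact splice_exact0 : exact (splice_diff 0) p.
Proof.
have [_ ejp _] := jp.
move=> y; rewrite ejp; split=> [[m <-]|[x <-]]; last by exists (res_aug X x).
by have [x <-] := res_aug_surj X m; exists x.
Qed.

Fact splice_exact i : exact (splice_diff i.+1) (splice_diff i).
Proof.
have [jI _ _] := jp.
case: i => [|i] y; last exact: diff_exact.
rewrite -[_ <-> _]/(j (res_aug X y) = 0 <-> exists x, res_diff X 0 x = y).
by rewrite -(aug_exact X) -{1}(linear0 j); split=> [/jI|->].
Qed.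

Definition splice : resolution M :=
  Resolution splice_surj splice_exact0 splice_exact.
End Splice.

(** A resolution without its first term resolves the first syzygy. The sign of
    the differential is the usual one for a shifted complex; it makes the
    horseshoe lemma below a special case of the lifting of chain maps. *)
Section Shift.
Variables (M M1 : lmodType R) (X : resolution M) (j : {linear M1 -> X 0}).
Variables (jI : injective j) (jX : exact j (res_aug X)).

Fact shift_aug_ex :
  exists a : {linear X 1%N -> M1}, forall x, j (a x) = - res_diff X 0 x.
Proof.
apply: (@factor_inj _ _ _ _ j (\- res_diff X 0) jI) => x.
by apply/jX; rewrite /= linearN res_aug0 oppr0.
Qed.
Definition shift_aug := sval (cid shift_aug_ex).
Lemma shift_augE x : j (shift_aug x) = - res_diff X 0 x.
Proof. exact: (svalP (cid shift_aug_ex)). Qed.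

Definition shift_term i := X i.+1.
Definition shift_diff i : {linear shift_term i.+1 -> shift_term i} :=
  \- res_diff X i.+1.

Fact shift_surj : surj shift_aug.
Proof.
move=> m; have /(aug_exact X _)[x xm] : res_aug X (j m) = 0.
  by apply/jX; exists m.
by exists (- x); apply: jI; rewrite shift_augE linearN opprK.
Qed.
Fact shift_exact0 : exact (shift_diff 0) shift_aug.
Proof.
move=> y; split=> [y0|[x <-]].
  have /(diff_exact X 0 _)[x xy] : res_diff X 0 y = 0.
    by apply: oppr_inj; rewrite -shift_augE y0 linear0 oppr0.
  by exists (- x); rewrite /= linearN opprK.
by apply: jI; rewrite shift_augE linearN res_diff0 !oppr0 linear0.
Qed.
Fact shift_exact i : exact (shift_diff i.+1) (shift_diff i).
Proof.
move=> y; split=> [/= /eqP|[x <-]].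
  rewrite oppr_eq0 => /eqP/(diff_exact X i.+1 _)[x xy].
  by exists (- x); rewrite /= linearN opprK.
by rewrite /= linearN res_diff0 !oppr0.
Qed.

Definition shift : resolution M1 := Resolution shift_surj shift_exact0 shift_exact.
End Shift.

Lemma splice_projective M M1 P (j : {linear M1 -> P}) (p : {linear P -> M})
    (X : resolution M1) (jp : short_exact j p) :
  projective P -> projective_resolution X -> projective_resolution (splice X jp).
Proof. by move=> Pp hX [|i]; [exact: Pp | exact: hX]. Qed.

Definition chain M N (X : resolution M) (Y : resolution N)
    (al : forall i, {linear X i -> Y i}) : Prop :=
  forall i x, res_diff Y i (al i.+1 x) = al i (res_diff X i x).

Definition lifts M N (X : resolution M) (Y : resolution N)
    (f : M -> N) (al : forall i, {linear X i -> Y i}) : Prop :=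
  forall x, res_aug Y (al 0 x) = f (res_aug X x).

(** Comparison of resolutions: the invariant of the recursion is that the lift
    found so far composes to zero with the next two differentials. *)
Lemma lift_ex M N (X : resolution M) (Y : resolution N) (f : {linear M -> N}) :
  projective_resolution X ->
  exists al : forall i, {linear X i -> Y i}, lifts f al /\ chain al.
Proof.
move=> pX.
have [a0 a0P] : exists a0 : {linear X 0 -> Y 0},
    forall x, res_aug Y (a0 x) = f (res_aug X x).
  exact: (proj_lift (pX 0) (f := f \o res_aug X) (fun x => res_aug_surj Y _)).
pose Inv i (t : {linear X i -> Y i}) : Prop :=
  match i return {linear X i -> Y i} -> Prop with
  | 0 => fun t => forall x, res_aug Y (t (res_diff X 0 x)) = 0
  | i'.+1 => fun t => forall x, res_diff Y i' (t (res_diff X i'.+1 x)) = 0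
  end t.
pose Rel i (t : {linear X i -> Y i}) (t' : {linear X i.+1 -> Y i.+1}) :=
  forall x, res_diff Y i (t' x) = t (res_diff X i x).
have [||al [al0 alP]] := @dependent_choice _ Inv Rel a0.
- by move=> x; rewrite a0P res_aug0 linear0.
- move=> i t ti.
  have [h hP] : exists h : {linear X i.+1 -> Y i.+1},
      forall x, res_diff Y i (h x) = t (res_diff X i x).
    case: i t ti => [|i] t ti.
      exact: (proj_lift_exact (f := t \o res_diff X 0) (pX 1%N) (aug_exact Y)).
    exact: (proj_lift_exact (f := t \o res_diff X i.+1) (pX i.+2) (diff_exact Y i)).
  by exists h; split=> // x; rewrite hP res_diff0 linear0.
by exists al; split=> [x|i]; [rewrite al0 a0P | exact: (alP i).2].
Qed.

Section Cocycles.
Variables (M : lmodType R) (X : resolution M) (Q : lmodType R).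

Definition cocyc i (z : X i -> Q) : Prop := forall x, z (res_diff X i x) = 0.

Definition cobound i : (X i -> Q) -> Prop :=
  match i return (X i -> Q) -> Prop with
  | 0 => fun z => forall x, z x = 0
  | i'.+1 => fun z =>
      exists y : {linear X i' -> Q}, forall x, z x = y (res_diff X i' x)
  end.

Lemma eq_cobound i (z w : X i -> Q) : z =1 w -> cobound z -> cobound w.
Proof. by move=> /funext->. Qed.

Lemma cobound0 i : cobound (fun _ : X i => 0).
Proof. by case: i => //= i; exists \0. Qed.

Lemma coboundD i (z w : X i -> Q) :
  cobound z -> cobound w -> cobound (fun x => z x + w x).
Proof.
case: i z w => [|i] z w /=; first by move=> z0 w0 x; rewrite z0 w0 addr0.
by move=> [y yP] [y' y'P]; exists (y \+ y') => x; rewrite yP y'P.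
Qed.

Lemma cobound_sum i n (z : 'I_n -> X i -> Q) :
  (forall k, cobound (z k)) -> cobound (fun x => \sum_k z k x).
Proof.
elim: n z => [|n IHn] z hz.
  by apply: eq_cobound (cobound0 i) => x; rewrite big_ord0.
apply: eq_cobound (coboundD (hz ord0) (IHn _ (fun k => hz (lift ord0 k)))) => x.
by rewrite big_ord_recl.
Qed.

Lemma cobound_cocyc i (z : X i -> Q) : cobound z -> cocyc z.
Proof.
case: i z => [|i] z /= h x; first exact: h.
by have [y ->] := h; rewrite res_diff0 linear0.
Qed.

End Cocycles.

Lemma cocyc_comp M N (X : resolution M) (Y : resolution N) Q
    (al : forall i, {linear X i -> Y i}) i (z : Y i -> Q) :
  chain al -> cocyc z -> cocyc (z \o al i).
Proof. by move=> hal hz x /=; rewrite -hal hz. Qed.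

Lemma cobound_comp M N (X : resolution M) (Y : resolution N) Q
    (al : forall i, {linear X i -> Y i}) i (z : Y i -> Q) :
  chain al -> cobound z -> cobound (z \o al i).
Proof.
move=> hal; case: i z => [|i] z /=; first by move=> h x; apply: h.
by move=> [y yP]; exists (y \o al i) => x; rewrite yP hal.
Qed.

(** A chain map lifting zero is null-homotopic; only the effect of the homotopy
    on cocycles is recorded. *)
Lemma null_cobound M N (X : resolution M) (Y : resolution N) Q
    (al : forall i, {linear X i -> Y i}) n (z : {linear Y n -> Q}) :
  projective_resolution X -> chain al -> lifts (fun=> 0) al ->
  cocyc z -> cobound (z \o al n).
Proof.
move=> pX hal al0 hz.
have [h0 h0P] : exists h : {linear X 0 -> Y 1%N},
    forall x, res_diff Y 0 (h x) = al 0 x.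
  by apply: (proj_lift_exact (pX 0) (aug_exact Y)) => x; rewrite al0.
case: n z hz => [|n] z hz; first by move=> x /=; rewrite -h0P hz.
suff [h [k hk]] : exists (h : {linear X n.+1 -> Y n.+2})
    (k : {linear X n -> Y n.+1}),
    forall x, al n.+1 x = res_diff Y n.+1 (h x) + k (res_diff X n x).
  by exists (z \o k) => x /=; rewrite hk linearD hz add0r.
elim: n {z hz} => [|n [h [k hk]]].
  have [|h hP] := @proj_lift_exact _ _ _ _ _ _ _
      (al 1%N \- (h0 \o res_diff X 0)) (pX 1%N) (diff_exact Y 0).
    by move=> x /=; rewrite linearB hal h0P subrr.
  by exists h, h0 => x; rewrite hP /= subrK.
have [|h' hP] := @proj_lift_exact _ _ _ _ _ _ _
    (al n.+2 \- (h \o res_diff X n.+1)) (pX n.+2) (diff_exact Y n.+1).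
  by move=> x /=; rewrite linearB hal hk res_diff0 linear0 addr0 subrr.
by exists h', h => x; rewrite hP /= subrK.
Qed.

Lemma lift_unique M N (X : resolution M) (Y : resolution N) Q (f : M -> N)
    (al be : forall i, {linear X i -> Y i}) n (z : {linear Y n -> Q}) :
  projective_resolution X -> chain al -> chain be -> lifts f al ->
  lifts f be -> cocyc z -> cobound (fun x => z (al n x) - z (be n x)).
Proof.
move=> pX hal hbe fal fbe hz.
apply: (@eq_cobound _ _ _ _ (z \o (al n \- be n))).
  by move=> x /=; rewrite linearB.
apply: (@null_cobound _ _ X Y Q (fun i => al i \- be i)) => // [i x|x] /=.
  by rewrite linearB hal hbe.
by rewrite linearB fal fbe subrr.
Qed.

(** Vanishing of Ext^i(M, Q). By ext_zeroP the choice of the resolution does not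
    matter. *)
Definition ext_zero i M Q : Prop := exists X : resolution M,
  projective_resolution X /\
  forall z : {linear X i -> Q}, cocyc z -> cobound z.

(** As Ext is additive, the identity of Ext(M, Q) factors through a finite power of
    Ext(N, Q). This covers the independence of resolutions, direct summands and
    finite direct sums at once. *)
Lemma ext_zero_factor i M N Q n (be : 'I_n -> {linear N -> M})
    (ga : 'I_n -> {linear M -> N}) (X : resolution M) :
  (forall x, x = \sum_k be k (ga k x)) -> projective_resolution X ->
  ext_zero i N Q -> forall z : {linear X i -> Q}, cocyc z -> cobound z.
Proof.
move=> idE pX [Y [pY hY]] z hz.
have [b bP] := choice (fun k => lift_ex X (be k) pY).
have [g gP] := choice (fun k => lift_ex Y (ga k) pX).
pose s m := sval (cid (linear_sum_ex (fun k => b k m \o g k m))).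
have sP m x : s m x = \sum_k b k m (g k m x).
  exact: (svalP (cid (linear_sum_ex (fun k => b k m \o g k m)))).
apply: (@eq_cobound _ _ _ _
  (fun x => (\sum_k z (b k i (g k i x))) + (z x - z (s i x)))).
  by move=> x; rewrite sP /= linear_sum addrC subrK.
apply: coboundD.
  apply: cobound_sum => k.
  apply: (@cobound_comp _ _ X Y Q (g k) i (z \o b k i) (gP k).2).
  apply: (hY (z \o b k i)).
  exact: (cocyc_comp (bP k).2 hz).
apply: (@lift_unique _ _ X X Q id (fun=> idfun) s) => // [m x|x].
  rewrite !sP linear_sum; apply: eq_bigr => k _ /=.
  by rewrite (bP k).2 (gP k).2.
rewrite sP linear_sum [in RHS](idE (res_aug X x)); apply: eq_bigr => k _ /=.
by rewrite (bP k).1 (gP k).1.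
Qed.

Lemma ext_zeroP i M Q (X : resolution M) :
  projective_resolution X -> ext_zero i M Q ->
  forall z : {linear X i -> Q}, cocyc z -> cobound z.
Proof.
move=> pX h z hz.
apply: (@ext_zero_factor i M M Q 1 (fun=> idfun) (fun=> idfun) X) => // x.
by rewrite big_ord1.
Qed.

End Resolutions.

Arguments aug_exact {R M} X.
Arguments diff_exact {R M} X i.

Lemma iterate_ex (T : Type) (C : T -> Prop) (S : T -> T -> Type) (t : T) :
  (forall t, C t -> exists t', C t' /\ inhabited (S t t')) -> C t ->
  exists (N : nat -> T) (s : forall i, S (N i) (N i.+1)),
    N 0 = t /\ forall i, C (N i).
Proof.
move=> step Ct.
have stepT (u : {t | C t}) : {v : {t | C t} & S (sval u) (sval v)}.
  have [t' h] := cid (step _ (svalP u)).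
  exists (exist _ t' h.1); exact: inhabited_witness h.2.
pose N := nat_rect (fun=> {t | C t}) (exist _ t Ct)
  (fun _ u => projT1 (stepT u)).
exists (fun i => sval (N i)), (fun i => projT2 (stepT (N i))).
by split=> // i; exact: svalP.
Qed.

Section MoreResolutions.
Variable R : pzRingType.
Implicit Types M N P Q : lmodType R.

Record middle (D : lmodType R -> Prop) M1 M := Middle {
  mid : lmodType R;
  mid_inj : {linear M1 -> mid};
  mid_surj : {linear mid -> M};
  mid_exact : short_exact mid_inj mid_surj;
  midP : D mid
}.

Section ResolutionOfSequence.
Variables (D : lmodType R -> Prop) (N : nat -> lmodType R).
Variable s : forall i, middle D (N i.+1) (N i).

Let X i := mid (s i).
Let d i : {linear X i.+1 -> X i} := mid_inj (s i) \o mid_surj (s i.+1).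

Fact seq_res_exact0 : exact (d 0) (mid_surj (s 0)).
Proof.
have [jI jp _] := mid_exact (s 0); have [_ _ ps] := mid_exact (s 1%N).
move=> y; rewrite jp; split=> [[m <-]|[x <-]].
  by have [x <-] := ps m; exists x.
by exists (mid_surj (s 1%N) x).
Qed.

Fact seq_res_exact i : exact (d i.+1) (d i).
Proof.
have [jI _ _] := mid_exact (s i); have [_ jp _] := mid_exact (s i.+1).
have [_ _ ps] := mid_exact (s i.+2).
move=> y; split=> [/= y0|[x <-] /=].
  have /jp[m <-] : mid_surj (s i.+1) y = 0 by apply: jI; rewrite y0 linear0.
  by have [x <-] := ps m; exists x.
have -> : mid_surj (s i.+1) (mid_inj (s i.+1) (mid_surj (s i.+2) x)) = 0.
  by apply/jp; exists (mid_surj (s i.+2) x).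
exact: linear0.
Qed.

Fact seq_res_surj : surj (mid_surj (s 0)).
Proof. by have [] := mid_exact (s 0). Qed.

Definition seq_res : resolution (N 0) :=
  Resolution seq_res_surj seq_res_exact0 seq_res_exact.
End ResolutionOfSequence.

(** Terms are chosen in D while the kernels stay in C: this gives both arbitrary
    projective resolutions and, over a noetherian ring, finitely generated ones. *)
Lemma resolution_ex (C D : lmodType R -> Prop) M :
  (forall M, C M -> exists P (p : {linear P -> M}), [/\ D P, surj p &
     forall M1 (j : {linear M1 -> P}), injective j -> exact j p -> C M1]) ->
  C M -> exists X : resolution M, forall i, D (X i).
Proof.
move=> step CM.
have [M' CM'|N [s [e _]]] := @iterate_ex _ C (fun M M1 => middle D M1 M) M _ CM.
  have [P [p [DP ps hC]]] := step _ CM'; have [K [j [jI jp]]] := kernel_ex p.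
  exists K; split; first exact: hC jI jp.
  by constructor; exact: (@Middle D _ _ P j p (And3 jI jp ps) DP).
by case: _ / e; exists (seq_res s) => i; exact: (midP (s i)).
Qed.

Lemma projective_resolution_ex M :
  exists X : resolution M, projective_resolution X.
Proof.
apply: (@resolution_ex (fun=> True) _ M) => // M' _.
by have [P [p [Pp ps]]] := enough_projectives M'; exists P, p.
Qed.

Lemma fg_resolution_ex M : noetherian_module (R^o : lmodType R) ->
  fg_module M -> exists X : resolution M,
    forall i, fg_module (X i) /\ projective (X i).
Proof.
move=> hR; apply: (@resolution_ex (@fg_module R)
  (fun P => fg_module P /\ projective P)) => M' /fg_cover[n [p ps]].
exists ('rV[R]_n : lmodType R), p; split=> //.
  by split; [exact: fg_row | exact: projective_row].
move=> M1 j jI jp.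
exact: fg_submod hR jI (fg_row R n).
Qed.

(** The horseshoe lemma: the extra component of the differential is a lift, to
    the shifted complex, of a map from the first syzygy of the quotient. *)
Lemma horseshoe_ex M1 M M2 (j : {linear M1 -> M}) (p : {linear M -> M2})
    (X : resolution M1) (Y : resolution M2) :
  short_exact j p -> projective_resolution Y ->
  exists (th : forall i, {linear Y i.+1 -> X i}) (ep : {linear Y 0 -> M}),
  [/\ forall b, p (ep b) = res_aug Y b,
      forall b, j (res_aug X (th 0 b)) = - ep (res_diff Y 0 b)
    & forall i b, res_diff X i (th i.+1 b) = - th i (res_diff Y i.+1 b)].
Proof.
move=> [jI jp ps] pY; have [ep epP] := pY 0 _ _ p (res_aug Y) ps.
have [K [k [kI kX]]] := kernel_ex (res_aug Y).
have [|g gP] := @factor_inj _ _ _ _ j (ep \o k) jI.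
  by move=> x /=; apply/jp; rewrite epP; apply/kX; exists x.
have [|th [th0 thS]] := @lift_ex _ _ _ (shift kI kX) X g.
  by move=> i; exact: (pY i.+1).
exists th, ep; split=> // [b|i b].
  by rewrite th0 gP /= shift_augE linearN.
by rewrite thS /= linearN.
Qed.

Section Horseshoe.
Variables (M1 M M2 : lmodType R) (j : {linear M1 -> M}) (p : {linear M -> M2}).
Variables (X : resolution M1) (Y : resolution M2).
Variables (th : forall i, {linear Y i.+1 -> X i}) (ep : {linear Y 0 -> M}).
Hypotheses (jp : short_exact j p) (hep : forall b, p (ep b) = res_aug Y b).
Hypothesis th0 : forall b, j (res_aug X (th 0 b)) = - ep (res_diff Y 0 b).
Hypothesis thS :
  forall i b, res_diff X i (th i.+1 b) = - th i (res_diff Y i.+1 b).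

Definition hs_term i : lmodType R := (X i * Y i)%type.

Fact hs_diff_linear i : linear (fun x : hs_term i.+1 =>
  (res_diff X i x.1 + th i x.2, res_diff Y i x.2) : hs_term i).
Proof.
move=> a x y; rewrite -[RHS]/(_, _) /= !linearP.
by rewrite scalerDr addrACA.
Qed.
Definition hs_diff i := linear_of (@hs_diff_linear i).

Definition hs_aug : {linear hs_term 0 -> M} :=
  (j \o (res_aug X \o fst)) \+ (ep \o snd).

Fact hs_surj : surj hs_aug.
Proof.
have [_ ejp _] := jp.
move=> m; have [b bm] := res_aug_surj Y (p m).
have /ejp[m1 m1E] : p (m - ep b) = 0 by rewrite linearB hep bm subrr.
have [a am] := res_aug_surj X m1.
by exists (a, b); rewrite /= am m1E subrK.
Qed.

Fact hs_exact0 : exact (hs_diff 0) hs_aug.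
Proof.
have [jI ejp _] := jp.
move=> [a b]; split=> /= [h|[[a1 b1] [<- <-]] /=]; last first.
  by rewrite linearD res_aug0 add0r th0 addNr.
have /(aug_exact Y)[b1 b1E] : res_aug Y b = 0.
  rewrite -hep -[RHS](linear0 p) -h linearD; apply/esym.
  by rewrite [p (j _)](_ : _ = 0) ?add0r //; apply/ejp; exists (res_aug X a).
have /(aug_exact X)[a1 a1E] : res_aug X (a - th 0 b1) = 0.
  by apply: jI; rewrite !linearB th0 b1E opprK h linear0.
by exists (a1, b1); rewrite /= a1E subrK b1E.
Qed.

Fact hs_exact i : exact (hs_diff i.+1) (hs_diff i).
Proof.
move=> [a b]; split=> [h|[[a1 b1] [<- <-]]]; last first.
  by rewrite /= linearD !res_diff0 add0r thS addNr.
have h1 : res_diff X i a + th i b = 0 := congr1 fst h.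
have h2 : res_diff Y i b = 0 := congr1 snd h.
have /(diff_exact Y i)[b1 b1E] := h2.
have /(diff_exact X i)[a1 a1E] : res_diff X i (a - th i.+1 b1) = 0.
  by rewrite linearB thS b1E opprK h1.
by exists (a1, b1); rewrite /= a1E subrK b1E.
Qed.

Definition hs : resolution M := Resolution hs_surj hs_exact0 hs_exact.

Lemma hs_projective : projective_resolution X -> projective_resolution Y ->
  projective_resolution hs.
Proof. by move=> pX pY i; exact: projective_prod. Qed.

(** A step of the construction of the connecting map: when y restricts to a
    coboundary on X, subtracting a coboundary from y leaves a cochain that only
    depends on the component in Y. *)
Lemma hs_restrict Q i (y : {linear hs i -> Q}) :
  cobound (fun a : X i => y (a, 0)) ->
  exists v : {linear Y i -> Q},
    forall x : hs i.+1, y (res_diff hs i x) = v (res_diff Y i x.2).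
Proof.
case: i y => [|i] y /=; [move=> y0 | move=> [w wP]].
  exists (y \o inr_lin (X 0) (Y 0)) => -[a b] /=.
  by rewrite pair_split linearD y0 add0r.
exists ((y \o inr_lin (X i.+1) (Y i.+1)) \- (w \o th i)) => -[a b] /=.
rewrite pair_split linearD wP linearD res_diff0 add0r thS linearN addrC.
by [].
Qed.

End Horseshoe.

Lemma ext_zero_mid M1 M M2 (j : {linear M1 -> M}) (p : {linear M -> M2}) Q i :
  short_exact j p -> ext_zero i M1 Q -> ext_zero i M2 Q -> ext_zero i M Q.
Proof.
move=> jp [X [pX hX]] [Y [pY hY]].
have [th [ep [hep th0 thS]]] := horseshoe_ex X jp pY.
pose H := hs jp hep th0 thS.
exists H; split=> [|z hz]; first exact: hs_projective.
pose zl : {linear X i -> Q} := z \o inl_lin (X i) (Y i).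
pose zr : {linear Y i -> Q} := z \o inr_lin (X i) (Y i).
have zE a b : z (a, b) = zl a + zr b by rewrite pair_split linearD.
have dl a : zl (res_diff X i a) = 0.
  by have := hz (a, 0); rewrite /= zE !linear0 !addr0.
have dr b : zl (th i b) + zr (res_diff Y i b) = 0.
  by have := hz (0, b); rewrite /= zE !linear0 add0r.
have := hX zl dl.
case: i z zl zr hz zE dl dr hX hY => [|i] z zl zr hz zE dl dr hX hY.
  move=> zl0 [a b]; rewrite zE zl0 add0r; apply: (hY zr) => b'.
  by have := dr b'; rewrite zl0 add0r.
move=> [w wP].
have [|u uP] := hY (zr \- (w \o th i)).
  move=> b /=; have := dr b; rewrite wP thS linearN => /eqP.
  by rewrite addrC => /eqP.
exists ((w \o fst) \+ (u \o snd)) => -[a b] /=.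
by rewrite zE wP linearD -uP /= -addrA; congr (_ + _); rewrite addrC subrK.
Qed.

Lemma ext_zero_quotient M1 M M2 (j : {linear M1 -> M}) (p : {linear M -> M2})
    Q i :
  short_exact j p -> ext_zero i M1 Q -> ext_zero i.+1 M Q ->
  ext_zero i.+1 M2 Q.
Proof.
move=> jp [X [pX hX]] hM; have [Y pY] := projective_resolution_ex M2.
have [th [ep [hep th0 thS]]] := horseshoe_ex X jp pY.
pose H := hs jp hep th0 thS.
exists Y; split=> // z hz.
have pH : projective_resolution H by exact: hs_projective.
have [|y yP] := ext_zeroP pH hM (z := z \o snd).
  by move=> [a b] /=; exact: hz.
have [|v vP] := @hs_restrict _ _ _ j p X Y th ep jp hep th0 thS _ _ y.
  apply: (hX (y \o inl_lin (X i) (Y i))) => a /=.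
  have := yP (a, 0); rewrite /= !linear0 addr0 => <-.
  by [].
by exists v => b; rewrite -(vP (0, b)) -yP.
Qed.

Lemma ext_zero_syzygy M1 P M (j : {linear M1 -> P}) (p : {linear P -> M}) Q i :
  short_exact j p -> projective P -> ext_zero i.+2 M Q -> ext_zero i.+1 M1 Q.
Proof.
move=> jp Pp hM; have [X pX] := projective_resolution_ex M1.
exists X; split=> // z hz.
have pS : projective_resolution (splice X jp) by exact: splice_projective.
exact: (@ext_zeroP _ i.+2 M Q (splice X jp) pS hM z hz).
Qed.

Lemma ext_zero_iso M N (f : {linear M -> N}) (g : {linear N -> M}) Q i :
  cancel f g -> ext_zero i N Q -> ext_zero i M Q.
Proof.
move=> fg hN; have [X pX] := projective_resolution_ex M.
exists X; split=> // z.
apply: (@ext_zero_factor _ i M N Q 1 (fun=> g) (fun=> f)) => //.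
by move=> x; rewrite big_ord1 fg.
Qed.

(** A cocycle on a finitely generated module only meets finitely many coordinates
    of Q, and each of its coordinates is a cocycle with values in R. *)
Lemma ext_zero_coef M Q i (X : resolution M) :
  (forall i, fg_module (X i) /\ projective (X i)) -> projective Q ->
  ext_zero i.+1 M (R^o : lmodType R) -> ext_zero i.+1 M Q.
Proof.
move=> hX Pq hM; have pX : projective_resolution X by move=> k; case: (hX k).
exists X; split=> // z hz.
have [n [c [y yP]]] := projective_coords z (hX i.+1).1 Pq.
have h k : exists w : {linear X i -> R^o},
    forall x, y k (z x) = w (res_diff X i x).
  by apply: (ext_zeroP pX hM (z := y k \o z)) => x /=; rewrite hz linear0.
have [w wP] := choice h.
have wl : linear (fun x : X i => \sum_k (w k x : R) *: c k).
  move=> a x x'; rewrite scaler_sumr -big_split.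
  by apply: eq_bigr => k _; rewrite linearP scalerDl -scalerA.
exists (linear_of wl) => x /=; rewrite {1}yP.
by apply: eq_bigr => k _; rewrite wP.
Qed.

(** V is the quotient of U x X_0 by X_1, for a projective resolution X of M; so the
    extension exists because the cocycle that f induces on X_1 is a coboundary. *)
Lemma ext_zero_extend (U V M Q : lmodType R)
    (j : {linear U -> V}) (p : {linear V -> M})
    (f : {linear U -> Q}) :
  short_exact j p -> ext_zero 1 M Q ->
  exists g : {linear V -> Q}, forall u, g (j u) = f u.
Proof.
move=> [jI jp ps] [X [pX hX]].
have [s0 s0P] := pX 0 _ _ p (res_aug X) ps.
have [|s1 s1P] := @factor_inj _ _ _ _ j (s0 \o res_diff X 0) jI.
  by move=> x /=; apply/jp; rewrite s0P res_aug0.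
have [|y yP] := hX (f \o s1).
  move=> x /=; rewrite (_ : s1 _ = 0) ?linear0 //; apply: jI.
  by rewrite s1P /= res_diff0 !linear0.
pose P := (j \o fst) \+ (s0 \o snd) : {linear (U * X 0)%type -> V}.
pose F := (f \o fst) \+ (y \o snd) : {linear (U * X 0)%type -> Q}.
have [||g gP] := @factor_surj _ _ _ _ P F.
- move=> v; have [x xv] := res_aug_surj X (p v).
  have /jp[u uE] : p (v - s0 x) = 0 by rewrite linearB s0P xv subrr.
  by exists (u, x); rewrite /= uE subrK.
- move=> [u x] /= h.
  have /(aug_exact X)[x1 x1E] : res_aug X x = 0.
    rewrite -s0P -[RHS](linear0 p) -h linearD.
    by rewrite [p (j u)](_ : _ = 0) ?add0r //; apply/jp; exists u.
  have -> : u = - s1 x1.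
    apply: jI; rewrite linearN s1P /= x1E; apply/eqP.
    by rewrite -addr_eq0 h.
  by rewrite linearN -x1E -yP /= addNr.
by exists g => u; have := gP (u, 0); rewrite /= !linear0 !addr0.
Qed.

End MoreResolutions.

(** * Gorenstein projective modules *)

Section Gorenstein.
Variable R : pzRingType.
Implicit Types M N P Q G H L : lmodType R.
Local Notation GP := (@gorenstein_projective R).

Definition perp M : Prop :=
  forall Q, projective Q -> forall i, ext_zero i.+1 M Q.

(** The part of a complete resolution above M is a projective resolution of M. *)
Lemma gp_perp M : GP M -> perp M.
Proof.
move=> [C [d [pC dd dQ [i [j [jI jP]]]]]] Q pQ k.
pose idx := nat_rect (fun=> int) (i + 1) (fun _ m => m + 1).
have [|aug augP] := @factor_inj _ _ _ _ j (d i) jI.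
  by move=> x; apply/jP; exists x.
have augS : surj aug.
  move=> m; have /jP[x xE] : exists m', j m' = j m by exists m.
  by exists x; apply: jI; rewrite augP.
have e0 : exact (d (idx 0)) aug.
  by move=> y; rewrite -(dd i) -augP -(linear0 j); split=> [->|/jI].
have eS n : exact (d (idx n.+1)) (d (idx n)) by exact: dd.
exists (@Resolution R M (fun n => C (idx n)) (fun n => d (idx n)) aug augS e0 eS).
split=> [n|z hz]; first exact: pC.
by have /(dQ Q pQ) := hz.
Qed.

Lemma gp_step M : GP M ->
  exists P G (j : {linear M -> P}) (p : {linear P -> G}),
  [/\ short_exact j p, projective P & GP G].
Proof.
move=> [C [d [pC dd dQ [i [j [jI jP]]]]]].
have [k ik] : exists k, i = k + 1 by exists (i - 1); rewrite subrK.
subst i; have [G [p [e [ps eI eP]]]] := image_ex (d k).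
exists (C (k + 1)), G, j, p; split=> //.
  split=> // y; rewrite jP -(dd k) -eP.
  by split=> [->|h]; [exact: linear0 | apply: eI; rewrite h linear0].
exists C, d; split=> //; exists k, e; split=> // y; split=> [[g <-]|[x <-]].
  by have [x <-] := ps g; exists x; rewrite eP.
by exists (p x).
Qed.

(** The resolution and the coresolution of a module are glued at the object
    with index -1, of which the module is a submodule. *)
Section Glue.
Variables (N : nat -> lmodType R) (X : resolution (N 0)).
Variable s : forall i, middle (@projective R) (N i) (N i.+1).

Definition glue (i : int) : lmodType R :=
  match i with Posz k => X k | Negz k => mid (s k) end.

Definition nexti (i : int) : int :=
  match i with Posz k => Posz k.+1 | Negz 0 => Posz 0 | Negz k.+1 => Negz k end.

Lemma nextiE i : i + 1 = nexti i.
Proof.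
case: i => [k|[|k]]; first by rewrite -PoszD addn1.
  by [].
by rewrite /= !NegzE -[k.+2]addn1 PoszD opprD addrNK.
Qed.

Definition glue_diff (i : int) : {linear glue (nexti i) -> glue i} :=
  match i return {linear glue (nexti i) -> glue i} with
  | Posz k => res_diff X k
  | Negz 0 => mid_inj (s 0) \o res_aug X
  | Negz k.+1 => mid_inj (s k.+1) \o mid_surj (s k)
  end.

Lemma glue_exact i : exact (glue_diff (nexti i)) (glue_diff i).
Proof.
have mI k : injective (mid_inj (s k)) by case: (mid_exact (s k)).
have mE k : exact (mid_inj (s k)) (mid_surj (s k)) by case: (mid_exact (s k)).
have mS k : surj (mid_surj (s k)) by case: (mid_exact (s k)).
case: i => [k|[|[|k]]] y.
- exact: diff_exact.
- split=> [/= y0|[x <-] /=]; last by rewrite res_aug0 linear0.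
  by apply/(aug_exact X); apply: (mI 0); rewrite y0 linear0.
- split=> [/= y0|[x <-] /=].
    have /(mE 0)[m <-] : mid_surj (s 0) y = 0.
      by apply: (mI 1%N); rewrite y0 linear0.
    by have [x xE] := res_aug_surj X m; exists x; rewrite xE.
  rewrite [mid_surj _ _](_ : _ = 0) ?linear0 //.
  by apply/(mE 0); exists (res_aug X x).
split=> [/= y0|[x <-] /=].
  have /(mE k.+1)[m <-] : mid_surj (s k.+1) y = 0.
    by apply: (mI k.+2); rewrite y0 linear0.
  by have [x xE] := mS k m; exists x; rewrite xE.
rewrite [mid_surj _ _](_ : _ = 0) ?linear0 //.
by apply/(mE k.+1); exists (mid_surj (s k) x).
Qed.

(** Exactness of Hom into Q on the coresolution is the extension of functionals
    along the embeddings of the N k, whose cokernels have no Ext^1 into Q. *)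
Lemma glue_hom i Q (h : {linear glue (nexti i) -> Q}) :
  projective_resolution X -> (forall k, perp (N k)) -> projective Q ->
  (forall x, h (glue_diff (nexti i) x) = 0) ->
  exists g : {linear glue i -> Q}, forall x, h x = g (glue_diff i x).
Proof.
move=> pX pN pQ.
have mE k : exact (mid_inj (s k)) (mid_surj (s k)) by case: (mid_exact (s k)).
have mS k : surj (mid_surj (s k)) by case: (mid_exact (s k)).
have extend k (u : {linear N k -> Q}) :
    exists v : {linear mid (s k) -> Q}, forall x, v (mid_inj (s k) x) = u x.
  exact: (ext_zero_extend u (mid_exact (s k)) (pN k.+1 Q pQ 0)).
case: i h => [k|[|k]] h hd.
- exact: (ext_zeroP pX (pN 0 Q pQ k) (z := h)).
- have [|u uP] := factor_surj (f := h) (res_aug_surj X).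
    by move=> x /(aug_exact X)[y <-]; exact: hd.
  by have [v vP] := extend 0 u; exists v => x /=; rewrite vP uP.
have [|u uP] := factor_surj (f := h) (mS k).
  move=> x /(mE k)[m <-] {x}.
  case: k h hd m => [|k] h hd m.
    by have [y <-] := res_aug_surj X m; exact: hd.
  by have [y <-] := mS k m; exact: hd.
by have [v vP] := extend k.+1 u; exists v => x /=; rewrite vP uP.
Qed.

Definition glue_cast (i k : int) (e : i = k) : {linear glue i -> glue k} :=
  match e in _ = k return {linear glue i -> glue k} with erefl => idfun end.

Lemma glue_gorenstein : projective_resolution X -> (forall k, perp (N k)) ->
  GP (N 0).
Proof.
move=> pX pN.
pose d i : {linear glue (i + 1) -> glue i} :=
  glue_diff i \o glue_cast (nextiE i).
have [mI mE mS] := mid_exact (s 0).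
exists glue, d; split.
- by move=> [k|k]; [exact: pX | exact: midP].
- move=> i; rewrite /d; move: (nextiE i) (nextiE (i + 1)).
  by move: (i + 1 + 1) => m1; move: (i + 1) => m e; subst m => e; subst m1;
    exact: glue_exact.
- move=> Q pQ i; rewrite /d; move: (nextiE i) (nextiE (i + 1)).
  move: (i + 1 + 1) => m1; move: (i + 1) => m e; subst m => e; subst m1.
  move=> h; split=> [hd|[g gP] x]; first exact: glue_hom.
  by rewrite gP -[RHS](linear0 g); congr (g _); apply/glue_exact; exists x.
exists (Negz 0), (mid_inj (s 0)); split=> // y.
rewrite /d; move: (nextiE (Negz 0)); move: (Negz 0 + 1) => m e; subst m.
split=> [[m <-]|[x <-]]; last by exists (res_aug X x).
by have [x xE] := res_aug_surj X m; exists x; rewrite /= xE.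
Qed.
End Glue.

(** Coinduction. Repeating the step gives the right half of a complete resolution;
    any projective resolution serves as its left half. Closure
    under extensions and under summands is obtained by choosing the class C. *)
Lemma gp_coind (C : lmodType R -> Prop) M :
  (forall M, C M -> perp M) ->
  (forall M, C M -> exists P M' (j : {linear M -> P}) (p : {linear P -> M'}),
     [/\ short_exact j p, projective P & C M']) ->
  C M -> GP M.
Proof.
move=> Cp step CM.
have [M' CM'|N [s [e CN]]] :=
    @iterate_ex _ C (fun M M1 => middle (@projective R) M M1) M _ CM.
  have [P [M1 [j [p [jp Pp CM1]]]]] := step _ CM'; exists M1; split=> //.
  by constructor; exact: (Middle jp Pp).
case: _ / e; have [X pX] := projective_resolution_ex (N 0).
by apply: (glue_gorenstein s pX) => k; apply: Cp.
Qed.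

Lemma gp_of_cosyzygy M P G (j : {linear M -> P}) (p : {linear P -> G}) :
  perp M -> short_exact j p -> projective P -> GP G -> GP M.
Proof.
move=> pM jp Pp gG.
pose C M := perp M /\ exists P G (j : {linear M -> P}) (p : {linear P -> G}),
  [/\ short_exact j p, projective P & GP G].
apply: (@gp_coind C) => [M' []|M' [_ [P' [G' [j' [p' [jp' Pp' gG']]]]]]|] //.
  exists P', G', j', p'; split=> //; split; first exact: gp_perp.
  exact: gp_step.
by split=> //; exists P, G, j, p.
Qed.

Lemma perp_mid M1 M M2 (j : {linear M1 -> M}) (p : {linear M -> M2}) :
  short_exact j p -> perp M1 -> perp M2 -> perp M.
Proof. by move=> jp h1 h2 Q pQ i; apply: ext_zero_mid jp _ _; auto. Qed.

Lemma gp_syzygy (W P G : lmodType R) (j : {linear W -> P}) (p : {linear P -> G}) :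
  short_exact j p -> projective P -> GP G -> GP W.
Proof.
move=> jp Pp gG; apply: (gp_of_cosyzygy _ jp Pp gG) => Q pQ i.
by apply: (ext_zero_syzygy jp Pp); apply: gp_perp.
Qed.

(** The dual horseshoe, for the pushout of L along the map a from M1 to X0. The
    image of w in P0 x P2 takes the place of the pushout, where w combines j0 with
    an extension to L of the map from M1 to P0. For a the identity, the pushout
    is L. *)
Lemma cosyzygy_extension (M1 X0 P0 H0 L G2 P2 H2 : lmodType R)
    (a : {linear M1 -> X0}) (j : {linear M1 -> L}) (p : {linear L -> G2})
    (j0 : {linear X0 -> P0}) (p0 : {linear P0 -> H0})
    (j2 : {linear G2 -> P2}) (p2 : {linear P2 -> H2}) :
  short_exact j p -> short_exact j0 p0 -> short_exact j2 p2 ->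
  projective P0 -> perp G2 ->
  exists (w : {linear (X0 * L)%type -> (P0 * P2)%type}) (G : lmodType R)
    (q : {linear (P0 * P2)%type -> G}) (f : {linear H0 -> G})
    (g : {linear G -> H2}),
  [/\ forall x, w (x, 0) = (j0 x, 0),
      forall m, w (0, j m) = (j0 (a m), 0),
      forall l, (w (0, l)).2 = j2 (p l),
      surj q /\ exact w q
    & short_exact f g].
Proof.
move=> jp jp0 jp2 pP0 pG2.
have [jI jpE ps] := jp; have [j0I jp0E p0s] := jp0; have [j2I jp2E p2s] := jp2.
have [e eP] := ext_zero_extend (j0 \o a) jp (pG2 P0 pP0 0).
have wl : linear (fun x : (X0 * L)%type =>
    (j0 x.1 + e x.2, j2 (p x.2)) : (P0 * P2)%type).
  by move=> c x y; rewrite -[RHS]/(_, _) /= !linearP scalerDr addrACA.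
pose w := linear_of wl.
have [G [q [qs qE]]] := coker_ex w.
have [|f fP] := factor_surj (f := q \o inl_lin P0 P2) p0s.
  move=> x /jp0E[x0 <-]; apply/qE; exists (x0, 0).
  by rewrite /= !linear0 addr0.
have [|g gP] := factor_surj (f := p2 \o snd) qs.
  move=> y /qE[[x l] <-] /=; apply/jp2E; exists (p l); by [].
exists w, G, q, f, g; split=> //.
- by move=> x; rewrite /= !linear0 addr0.
- move=> m; rewrite /= eP linear0 add0r; congr (_, _).
  by rewrite [p _](_ : _ = 0) ?linear0 //; apply/jpE; exists m.
split.
- apply/inj0P => h; have [x <-] := p0s h; rewrite fP => /qE[[x0 l] xl].
  have xE : j0 x0 + e l = x := congr1 fst xl.
  have lE : j2 (p l) = 0 := congr1 snd xl.
  have /jpE[m mE] : p l = 0 by apply: j2I; rewrite lE linear0.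
  apply/jp0E; exists (x0 + a m); rewrite linearD -xE -mE eP //.
- move=> y; have [[x z] <-] := qs y; rewrite gP /=; split.
    move=> /jp2E[g2 g2E]; have [l lE] := ps g2.
    exists (p0 (x - e l)); rewrite fP /=.
    apply/eqP; rewrite -subr_eq0 -linearB; apply/eqP/qE.
    exists (0, - l); rewrite /= !linearN linear0 add0r lE g2E.
    by rewrite -[RHS]/(_, _) /= add0r addrAC subrr add0r.
  move=> [h hE]; have [x1 x1E] := p0s h.
  have : g (f h) = 0 by rewrite -x1E fP /= gP /= linear0.
  by rewrite hE gP.
by move=> h; have [z <-] := p2s h; exists (q (0, z)); rewrite gP.
Qed.

(** The cosyzygy of an extension is an extension of the cosyzygies. *)
Lemma gp_extension M1 M M2 (j : {linear M1 -> M}) (p : {linear M -> M2}) :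
  short_exact j p -> GP M1 -> GP M2 -> GP M.
Proof.
move=> jp g1 g2.
pose C M := exists M1 M2 (j : {linear M1 -> M}) (p : {linear M -> M2}),
  [/\ short_exact j p, GP M1 & GP M2].
apply: (@gp_coind C) => [N|N|]; last by exists M1, M2, j, p.
  move=> [N1 [N2 [k [q [kq h1 h2]]]]].
  by apply: perp_mid kq _ _; apply: gp_perp.
move=> [N1 [N2 [k [q [kq h1 h2]]]]].
have [P1 [H1 [j1 [p1 [jp1 pP1 gH1]]]]] := gp_step h1.
have [P2 [H2 [j2 [p2 [jp2 pP2 gH2]]]]] := gp_step h2.
have [w [G [r [f [g [w1 w2 w3 [rs rE] fg]]]]]] :=
  cosyzygy_extension idfun kq jp1 jp2 pP1 (gp_perp h2).
exists (P1 * P2)%type, G, (w \o inr_lin N1 N), r; split.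
- split=> //.
    apply/inj0P => m /= wm; have [kI kE _] := kq.
    have [j1I _ _] := jp1; have [j2I _ _] := jp2.
    have /kE[n nE] : q m = 0 by apply: j2I; rewrite -w3 wm !linear0.
    move: wm; rewrite -nE w2 => /(congr1 fst) /= h.
    by rewrite [n](_ : _ = 0) ?linear0 //; apply: j1I; rewrite h linear0.
  move=> y; rewrite rE; split=> [[[x m] <-]|[m <-]]; last by exists (0, m).
  exists (k x + m).
  change (w (inr_lin N1 N (k x + m)) = w (x, m)).
  rewrite pair_split !linearD; congr (_ + _).
  exact: etrans (w2 x) (esym (w1 x)).
- exact: projective_prod.
by exists H1, H2, f, g.
Qed.

Lemma prod_exact (U V W U' V' W' : lmodType R)
    (f : {linear U -> V}) (g : {linear V -> W})
    (f' : {linear U' -> V'}) (g' : {linear V' -> W'}) :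
  short_exact f g -> short_exact f' g' ->
  exists (F : {linear (U * U')%type -> (V * V')%type})
         (G : {linear (V * V')%type -> (W * W')%type}),
  [/\ forall x, F x = (f x.1, f' x.2), forall x, G x = (g x.1, g' x.2)
    & short_exact F G].
Proof.
move=> [fI fg gs] [f'I fg' gs'].
have Fl : linear (fun x : (U * U')%type => (f x.1, f' x.2) : (V * V')%type).
  by move=> a x y; rewrite -[RHS]/(_, _) /= !linearP.
have Gl : linear (fun x : (V * V')%type => (g x.1, g' x.2) : (W * W')%type).
  by move=> a x y; rewrite -[RHS]/(_, _) /= !linearP.
exists (linear_of Fl), (linear_of Gl); split=> //; split.
- by move=> [x x'] [y y'] /= e; congr (_, _); [apply: fI | apply: f'I]; case: e.
- move=> [y y']; split=> [h|[[x x'] <-] /=].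
    have /fg[x <-] : g y = 0 := congr1 fst h.
    have /fg'[x' <-] : g' y' = 0 := congr1 snd h.
    by exists (x, x').
  by congr (_, _); [apply/fg; exists x | apply/fg'; exists x'].
by move=> [y y']; have [x <-] := gs y; have [x' <-] := gs' y'; exists (x, x').
Qed.

End Gorenstein.

(** * Finite Gorenstein projective dimension *)

Section Hulls.
Variable R : pzRingType.
Implicit Types M N P Q G H L : lmodType R.
Local Notation GP := (@gorenstein_projective R).

Lemma prod_ses M N : exists (j : {linear M -> (M * N)%type})
    (p : {linear (M * N)%type -> N}),
  [/\ forall x, j x = (x, 0), forall y, p y = y.2 & short_exact j p].
Proof.
exists (inl_lin M N), snd; split=> //; split.
- by move=> x y [].
- by move=> [x y]; split=> /= [->|[m [_ <-]] //]; exists x.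
by move=> y; exists (0, y).
Qed.

Lemma gp_prod M N : GP M -> GP N -> GP (M * N)%type.
Proof.
move=> gM gN; have [j [p [_ _ jp]]] := prod_ses M N.
exact: gp_extension jp gM gN.
Qed.

(** If D is a summand of a Gorenstein projective module H, with complement D',
    and H lies in a projective P with Gorenstein projective cokernel H', then the
    cokernel V of D in P is again a summand of a Gorenstein projective module,
    as the direct sum of V and D is an extension of H' by H. *)
Lemma gp_summand (D D' : lmodType R) : GP (D * D')%type -> GP D.
Proof.
move=> gDD.
pose C (D : lmodType R) := exists D' : lmodType R, GP (D * D')%type.
apply: (@gp_coind _ C) => [{gDD D'}D [D' gD]|{gDD D'}D [D' gD]|];
  last by exists D'.
  move=> Q pQ i; have [a [_ [aE _ _]]] := prod_ses D D'.
  apply: (@ext_zero_iso _ _ _ a fst) => [x|]; first by rewrite aE.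
  exact: gp_perp.
have [P [H [j [p [jp pP gH]]]]] := gp_step gD.
have [a [_ [aE _ _]]] := prod_ses D D'.
pose b := inr_lin D D'.
have [V [q [qs qE]]] := coker_ex (j \o a).
have [jI jE ps] := jp.
exists P, V, (j \o a), q; split=> //.
  by split=> //; apply: inj_comp => // x y; rewrite !aE => -[].
exists D.
have [|g gP] := factor_surj (f := p) qs.
  by move=> x /qE[y <-] /=; apply/jE; exists (a y).
have Fl : linear (fun x : (D * D')%type =>
    (q (j (b x.2)), x.1) : (V * D)%type).
  by move=> c x y; rewrite -[RHS]/(_, _) !linearP.
apply: (@gp_extension _ _ _ _ (linear_of Fl) (g \o fst)) gD gH; split.
- apply/inj0P => -[x y] h; have x0 : x = 0 := congr1 snd h.
  have /qE[x' x'E] : q (j (b y)) = 0 := congr1 fst h.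
  by have := jI _ _ x'E; rewrite aE x0 => -[_ <-].
- move=> [v x]; split=> [/= gv|[[x' y] [<- <-]] /=]; last first.
    by rewrite gP; apply/jE; exists (b y).
  have [t tE] := qs v; move: gv; rewrite -tE gP => /jE[[x' y] xyE].
  exists (x, y); congr (_, _) => /=.
  apply/eqP; rewrite -subr_eq0 -linearB -xyE -linearB; apply/eqP/qE.
  exists (- x'); rewrite /= aE; congr (j _).
  by rewrite -[RHS]/(_, _) /= add0r subrr.
by move=> h; have [x <-] := ps h; exists (q x, 0); rewrite /= gP.
Qed.

Lemma zero_ses L :
  short_exact (\0 : {linear zero_mod R -> L}) (idfun : {linear L -> L}).
Proof.
split=> [x y _|y|y]; last by exists y.
  by rewrite (zero_mod_trivial x) (zero_mod_trivial y).
by split=> [/= y0|[x <-] //]; exists 0.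
Qed.

(** Finite projective dimension, in the form suited to induction. *)
Inductive fpd : lmodType R -> Prop :=
| fpd_projective L : projective L -> fpd L
| fpd_step L1 P L (j : {linear L1 -> P}) (p : {linear P -> L}) :
    short_exact j p -> projective P -> fpd L1 -> fpd L.

Lemma fpd_cover L : fpd L ->
  exists L1 P (j : {linear L1 -> P}) (p : {linear P -> L}),
    [/\ short_exact j p, projective P & fpd L1].
Proof.
case=> {}L => [pL|P L' j p jp pP fL]; last by exists L, P, j, p.
exists (zero_mod R), L, \0, idfun; split=> //; first exact: zero_ses.
by apply/fpd_projective/trivial_projective/zero_mod_trivial.
Qed.

(** Without Ext into projectives, the first syzygy is projective by induction, and
    then the cover splits. *)
Lemma fpd_perp_projective L : fpd L -> perp L -> projective L.
Proof.
elim=> {L} // L1 P L j p jp pP _ IH pL.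
have pL1 : projective L1.
  by apply: IH => Q pQ i; apply: (ext_zero_syzygy jp pP); apply: pL.
have [g gP] := ext_zero_extend idfun jp (pL L1 pL1 0).
have [jI jE ps] := jp.
have [|s sP] := factor_surj (f := idfun \- (j \o g)) ps.
  by move=> x /jE[y <-] /=; rewrite gP subrr.
apply: (@projective_retract _ _ _ s p _ pP) => l; have [x <-] := ps l.
rewrite sP /= linearB [p (j _)](_ : _ = 0) ?subr0 //.
by apply/jE; exists (g x).
Qed.

Lemma fpd_projective_prod L L' :
  fpd L' -> projective L -> fpd (L * L')%type.
Proof.
move=> fL'; elim: fL' L => {L'} [L' pL'|L1 P L' j p jp pP _ IH] L pL.
  exact/fpd_projective/projective_prod.
have [F [G [_ _ FG]]] := prod_exact (zero_ses L) jp.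
apply: fpd_step FG (projective_prod pL pP) (IH _ _).
exact/trivial_projective/zero_mod_trivial.
Qed.

Lemma fpd_prod L L' : fpd L -> fpd L' -> fpd (L * L')%type.
Proof.
move=> fL; elim: fL L' => {L} [L pL|L1 P L j p jp pP _ IH] L' fL'.
  exact: fpd_projective_prod.
have [L1' [P' [j' [p' [jp' pP' fL1']]]]] := fpd_cover fL'.
have [F [G [_ _ FG]]] := prod_exact jp jp'.
exact: fpd_step FG (projective_prod pP pP') (IH _ fL1').
Qed.

(** The notion that replaces finite Gorenstein projective dimension: unlike a
    resolution by Gorenstein projectives, a hull passes easily to syzygies, and a
    module without Ext into projectives that has a hull is Gorenstein projective
    because L must be projective. *)
Definition hull M : Prop :=
  exists L G (j : {linear M -> L}) (p : {linear L -> G}),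
  [/\ short_exact j p, fpd L & GP G].

Lemma hull_iso M N (f : {linear M -> N}) : bijective f -> hull N -> hull M.
Proof.
move=> [g gK fK] [L [G [j [p [[jI jE ps] fL gG]]]]].
exists L, G, (j \o f), p; split=> //; split=> //.
  exact: inj_comp jI (can_inj gK).
move=> y; rewrite jE; split=> [[m <-]|[m <-]]; last by exists (f m).
by exists (g m); rewrite /= fK.
Qed.

Lemma gp_hull M : GP M -> hull M.
Proof.
move=> /gp_step[P [G [j [p [jp pP gG]]]]].
by exists P, G, j, p; split=> //; exact: fpd_projective.
Qed.

Lemma hull_prod M N : hull M -> hull N -> hull (M * N)%type.
Proof.
move=> [L [G [j [p [jp fL gG]]]]] [L' [G' [j' [p' [jp' fL' gG']]]]].
have [f [g [_ _ fg]]] := prod_exact jp jp'.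
exists (L * L')%type, (G * G')%type, f, g.
by split=> //; [exact: fpd_prod | exact: gp_prod].
Qed.

Lemma hull_perp_gp M : hull M -> perp M -> GP M.
Proof.
move=> [L [G [j [p [jp fL gG]]]]] pM.
apply: (gp_of_cosyzygy pM jp _ gG); apply: fpd_perp_projective => //.
by apply: perp_mid jp pM _; apply: gp_perp.
Qed.

(** Induction on the length of the resolution: a hull L1 of the first syzygy M1 of
    M, and embeddings of X_0 and of L1 / M1 into projectives P0 and P2, give in
    P0 x P2 a copy of the pushout of L1 and X_0 along M1. The quotient of P0 x P2
    by L1 is a hull of M. *)
Lemma finite_gpd_hull M : finite_gpd M -> hull M.
Proof.
move=> [m [X [gX tX]]]; elim: m M X gX tX => [|d IH] M X gX tX.
  have augI : injective (res_aug X).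
    apply/inj0P => x /(aug_exact X)[y <-].
    by rewrite (tX 1%N isT y) linear0.
  have [g [gK augK]] := inverse_ex augI (res_aug_surj X).
  apply: (@hull_iso _ _ g); first by exists (res_aug X).
  exact/gp_hull/gX.
have [M1 [k [kI kX]]] := kernel_ex (res_aug X).
have [||L1 [G2 [j [p [jp fL1 gG2]]]]] := IH M1 (shift kI kX).
- by move=> i; exact: (gX i.+1).
- by move=> i; exact: (tX i.+1).
have [P0 [H0 [j0 [p0 [jp0 pP0 gH0]]]]] := gp_step (gX 0 isT).
have [P2 [H2 [j2 [p2 [jp2 pP2 gH2]]]]] := gp_step gG2.
have [w [G [q [f [g [w1 w2 w3 [qs qE] fg]]]]]] :=
  cosyzygy_extension k jp jp0 jp2 pP0 (gp_perp gG2).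
have gG : GP G by exact: gp_extension fg gH0 gH2.
have [jI jE ps] := jp; have [j0I _ _] := jp0; have [j2I _ _] := jp2.
pose wl : {linear X 0 -> (P0 * P2)%type} := w \o inl_lin (X 0) L1.
pose wr : {linear L1 -> (P0 * P2)%type} := w \o inr_lin (X 0) L1.
have wE x l : w (x, l) = wl x + wr l.
  by rewrite pair_split linearD.
have wlE x : wl x = (j0 x, 0) := w1 x.
have wrE l : (wr l).2 = j2 (p l) := w3 l.
have wrj m : wr (j m) = (j0 (k m), 0) := w2 m.
have w_inj x l : wl x = wr l -> exists m, l = j m /\ x = k m.
  move=> e; have /jE[m mE] : p l = 0.
    by apply: j2I; rewrite -wrE -e wlE linear0.
  exists m; split=> //; apply: j0I.
  by have := congr1 fst e; rewrite wlE -mE wrj.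
have [L [c [cs cE]]] := coker_ex wr.
have wrI : injective wr.
  apply/inj0P => l wl0; have [|m [-> m0]] := w_inj 0 l.
    by rewrite linear0 wl0.
  by rewrite [m](_ : _ = 0) ?linear0 //; apply: kI; rewrite -m0 linear0.
have fL : fpd L by apply: fpd_step (And3 wrI cE cs) _ fL1; exact: projective_prod.
have [|u uP] := factor_surj (f := c \o wl) (res_aug_surj X).
  move=> x /kX[m <-] /=; apply/cE; exists (j m).
  by rewrite wrj -wlE.
have [|v vP] := factor_surj (f := q) cs.
  by move=> y /cE[l <-]; apply/qE; exists (0, l).
exists L, G, u, v; split=> //; split.
- apply/inj0P => m; have [x <-] := res_aug_surj X m; rewrite uP => /cE[l lE].
  by have [m' [_ ->]] := w_inj x l (esym lE); apply/kX; exists m'.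
- move=> y; have [z <-] := cs y; rewrite vP; split=> [/qE[[x l] <-]|[m mE]].
    exists (res_aug X x); rewrite uP wE linearD.
    by rewrite [c (wr l)](_ : _ = 0) ?addr0 //; apply/cE; exists l.
  have [x xE] := res_aug_surj X m; move: mE; rewrite -xE uP => e.
  by rewrite -vP -e /= vP; apply/qE; exists (x, 0).
by move=> g'; have [z <-] := qs g'; exists (c z); rewrite vP.
Qed.

(** Let P' be a projective module that maps onto L, with kernel L1, and let W be
    the preimage of M in P'. Then M1 is the kernel of a surjection from L1 x P to
    W, and W is Gorenstein projective because P' / W = L / M. *)
Lemma hull_syzygy M1 P M (i : {linear M1 -> P}) (r : {linear P -> M}) :
  short_exact i r -> projective P -> hull M -> hull M1.
Proof.
move=> [iI iE rs] pP [L [G [j [p [[jI jE ps] fL gG]]]]].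
have [L1 [P' [l [c [[lI lE cs] pP' fL1]]]]] := fpd_cover fL.
have [s sP] := pP _ _ c (j \o r) cs.
have [W [k [kI kE]]] := kernel_ex (p \o c).
have pcs : surj (p \o c).
  by move=> g; have [y <-] := ps g; have [x <-] := cs y; exists x.
have gW : GP W by exact: gp_syzygy (And3 kI kE pcs) pP' gG.
pose e := (l \o fst) \+ (s \o snd) : {linear (L1 * P)%type -> P'}.
have [|e' e'P] := factor_inj (f := e) kI.
  move=> [x y]; apply/kE => /=; rewrite linearD sP.
  rewrite [c (l x)](_ : _ = 0) ?add0r; last by apply/lE; exists x.
  by apply/jE; exists (r y).
have [|t tP] := factor_inj (f := \- (s \o i)) lI.
  move=> m; apply/lE; rewrite /= linearN sP /=.
  by rewrite [r _](_ : _ = 0) ?linear0 ?oppr0 //; apply/iE; exists m.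
have ml : linear (fun m : M1 => (t m, i m) : (L1 * P)%type).
  by move=> a x y; rewrite -[RHS]/(_, _) /= !linearP.
exists (L1 * P)%type, W, (linear_of ml), e'; split=> //.
  split.
  - by move=> x y [_] /iI.
  - move=> [x y]; split=> [h|[m [<- <-]]]; last first.
      by apply: kI; rewrite e'P /= tP linear0 /= addNr.
    have xy : l x + s y = 0 by have := e'P (x, y); rewrite h linear0.
    have /iE[m mE] : r y = 0.
      apply: jI; rewrite linear0 -[j _]sP -[RHS](linear0 c) -xy linearD.
      by rewrite [c (l x)](_ : _ = 0) ?add0r //; apply/lE; exists x.
    exists m; congr (_, _) => //; apply: lI; rewrite tP /= mE.
    by apply/eqP; rewrite eq_sym -addr_eq0 xy.
  move=> w; have /kE/jE[m mE] : exists x, k x = k w by exists w.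
  have [y yE] := rs m.
  have /lE[x xE] : c (k w - s y) = 0 by rewrite linearB sP /= yE mE subrr.
  by exists (x, y); apply: kI; rewrite e'P /= xE subrK.
by apply: fpd_prod => //; exact: fpd_projective.
Qed.

(** Reasoning by induction along a resolution about a cokernel S of its
    differential in degree n, that is, about an n-th syzygy of M. *)
Lemma syzygy_ind (D : lmodType R -> Prop) (C : nat -> lmodType R -> Prop)
    (S : lmodType R) :
  (forall M (f : {linear M -> S}), bijective f -> C 0 M) ->
  (forall n M M1 P (j : {linear M1 -> P}) (p : {linear P -> M}),
     short_exact j p -> D P -> C n M1 -> C n.+1 M) ->
  forall n M (X : resolution M) (p : {linear X n -> S}),
    (forall i, D (X i)) -> exact (res_diff X n) p -> surj p -> C n M.
Proof.
move=> h0 hS; elim=> [|n IH] M X p DX pE ps.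
  have [|f fP] := factor_surj (f := p) (res_aug_surj X).
    by move=> x /(aug_exact X)[y <-]; apply/pE; exists y.
  have [|g gP] := factor_surj (f := res_aug X) ps.
    by move=> x /pE[y <-]; exact: res_aug0.
  apply: (h0 M f); exists g => x.
    by have [y <-] := res_aug_surj X x; rewrite fP gP.
  by have [y <-] := ps x; rewrite gP fP.
have [M1 [k [kI kX]]] := kernel_ex (res_aug X).
apply: (hS n M M1 (X 0) k (res_aug X) (And3 kI kX (res_aug_surj X)) (DX 0)).
apply: (IH M1 (shift kI kX) p) => // [i|y]; first exact: (DX i.+1).
rewrite pE; split=> -[x <-]; exists (- x); rewrite /= linearN ?opprK //.
Qed.

End Hulls.

(** * Syzygies and projective dimension *)

Section Consequences.
Variable R : pzRingType.
Implicit Types M N P Q G H L : lmodType R.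
Local Notation GP := (@gorenstein_projective R).

Lemma linear_inverse M N (f : {linear M -> N}) : bijective f ->
  exists g : {linear N -> M}, cancel f g /\ cancel g f.
Proof.
move=> [g gK fK]; apply: inverse_ex (can_inj gK) _ => y.
by exists (g y).
Qed.

Definition zero_res M (M0 : trivial_module M) : resolution M.
Proof.
apply: (@Resolution R M (fun=> zero_mod R) (fun=> \0) \0).
- by move=> m; exists 0; rewrite (M0 m) linear0.
- by move=> y; split=> // _; exists 0; rewrite (zero_mod_trivial y).
by move=> i y; split=> // _; exists 0; rewrite (zero_mod_trivial y).
Defined.

Lemma pd_le_trivial M : trivial_module M -> pd_le (0%:Z - 1) M.
Proof.
move=> M0; exists (zero_res M0); split=> [i|i _].
  exact/trivial_projective/zero_mod_trivial.
exact: zero_mod_trivial.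
Qed.

Lemma pd_le_step n M1 P M (j : {linear M1 -> P}) (p : {linear P -> M}) :
  short_exact j p -> projective P -> pd_le (n%:Z - 1) M1 ->
  pd_le (n.+1%:Z - 1) M.
Proof.
move=> jp pP [X [pX tX]]; exists (splice X jp).
split=> [|[|i]]; first exact: splice_projective.
  by rewrite -addn1 PoszD addrK.
move=> h; apply: (tX i); move: h.
by rewrite -addn1 PoszD addrK Num.Theory.ltrBlDr -PoszD addn1.
Qed.

Lemma syzygy0 M S : isomorphic S M -> is_syzygy 0 M S.
Proof.
move=> SM; exists (splice (zero_res (@zero_mod_trivial R)) (zero_ses M)).
by split=> // -[|i] // _; exact: zero_mod_trivial.
Qed.

Lemma syzygyS n M M1 P S (j : {linear M1 -> P}) (p : {linear P -> M}) :
  short_exact j p -> fg_module P /\ projective P -> is_syzygy n M1 S ->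
  is_syzygy n.+1 M S.
Proof.
move=> jp hP [X [h1 h2 h3]]; exists (splice X jp); split=> //.
  by move=> [|i] // ?; exact: h1.
by move=> [|i] // ?; exact: h2.
Qed.

Section Syzygies.
Variables (n : nat) (M : lmodType R) (X : resolution M) (S : lmodType R).
Variables (p : {linear X n -> S}).
Hypotheses (pE : exact (res_diff X n) p) (ps : surj p).

Lemma is_syzygy_coker : (forall i, fg_module (X i) /\ projective (X i)) ->
  is_syzygy n M S.
Proof.
move=> hX.
apply: (syzygy_ind (D := fun P => fg_module P /\ projective P) (S := S)
    (C := fun n M => is_syzygy n M S) _ _ hX pE ps).
  move=> M' f /linear_inverse[g [fg gf]]; apply: syzygy0.
  by exists g; exists f.
by move=> m M' M1 P j q; exact: syzygyS.
Qed.

Lemma hull_syz : projective_resolution X -> hull M -> hull S.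
Proof.
move=> pX; pose C (_ : nat) M := hull M -> hull S.
apply: (syzygy_ind (S := S) (C := C) _ _ pX pE ps).
  move=> M' f /linear_inverse[g [fg gf]]; apply: (hull_iso (f := g)).
  by exists f.
by move=> m M' M1 P j q jq pP h1 hM'; apply: h1; exact: (hull_syzygy jq).
Qed.

Lemma ext_zero_syz Q : projective_resolution X ->
  (forall i, ext_zero (n + i).+1 M Q) -> forall i, ext_zero i.+1 S Q.
Proof.
move=> pX.
pose C n M := (forall i, ext_zero (n + i).+1 M Q) ->
  forall i, ext_zero i.+1 S Q.
apply: (syzygy_ind (S := S) (C := C) _ _ pX pE ps).
  move=> M' f /linear_inverse[g [fg gf]] h i.
  exact: (ext_zero_iso gf (h i)).
move=> m M' M1 P j q jq pP h1 hM'; apply: h1 => i.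
exact: (ext_zero_syzygy jq pP (hM' i)).
Qed.

End Syzygies.

Lemma gp_trivial M : trivial_module M -> GP M.
Proof.
move=> M0; exists (fun=> zero_mod R), (fun=> \0); split.
- by move=> _; exact/trivial_projective/zero_mod_trivial.
- by move=> i y; split=> // _; exists 0; rewrite (zero_mod_trivial y).
- move=> Q _ i f; split=> [_|_ x]; last exact: linear0.
  by exists \0 => x; rewrite (zero_mod_trivial x) !linear0.
exists 0, \0; split=> [x y _|y]; first by rewrite (M0 x) (M0 y).
by split=> _; exists 0; rewrite (zero_mod_trivial y).
Qed.

Lemma ext_zero0P M Q :
  ext_zero 0 M Q <-> forall (f : {linear M -> Q}) x, f x = 0.
Proof.
split=> [[X [pX hX]] f m|h].
  have [x <-] := res_aug_surj X m.
  by apply: (hX (f \o res_aug X)) => y /=; rewrite res_aug0 linear0.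
have [X pX] := projective_resolution_ex M; exists X; split=> // z hz x.
have [|f fP] := factor_surj (f := z) (res_aug_surj X).
  by move=> y /(aug_exact X)[x' <-]; exact: hz.
by rewrite -fP h.
Qed.

Lemma fg_prod M N : fg_module M -> fg_module N -> fg_module (M * N)%type.
Proof.
move=> /fg_cover[n [p ps]] /fg_cover[m [q qs]].
have fl : linear (fun x : 'rV[R]_(n + m) =>
    (p (lsubmx x), q (rsubmx x)) : (M * N)%type).
  by move=> a x y; rewrite -[RHS]/(_, _) /= !linearP.
apply: (@fg_surj _ _ _ (linear_of fl)) (fg_row R (n + m)) => -[x y].
have [x' <-] := ps x; have [y' <-] := qs y.
by exists (row_mx x' y'); rewrite /= row_mxKl row_mxKr.
Qed.

Lemma cocycleP M (X : resolution M) i (z : dual (X i)) :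
  cocycle z <-> cocyc (Q := (R^o : lmodType R)) (dual_fun z).
Proof.
split=> [zd x|zd]; last by apply: dualP => x; exact: zd.
exact: (congr1 (fun w : dual _ => dual_fun w x) zd).
Qed.

Lemma coboundaryP M (X : resolution M) i (z : dual (X i)) :
  coboundary z <-> cobound (Q := (R^o : lmodType R)) (dual_fun z).
Proof.
case: i z => [|i] z /=; first by split=> [-> //|h]; apply: dualP.
by split=> -[y yP]; exists y; [rewrite yP | apply: dualP].
Qed.

Lemma ext_vanishesE i M : ext_vanishes i M -> ext_zero i M (R^o : lmodType R).
Proof.
move=> [X [pX hX]]; exists X; split=> // z hz.
by apply/(coboundaryP (z : dual (X i))); apply: hX; apply/cocycleP.
Qed.

End Consequences.

(** * Restriction of scalars *)

Section Restriction.
Variables (R A : pzRingType) (phi : {rmorphism R -> A}).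
Local Notation rs := (restr phi).

Fact rmap_linear (M N : lmodType A) (u : {linear M -> N}) :
  linear (u : rs M -> rs N).
Proof. by move=> a x y; rewrite -[a *: x]/(phi a *: (x : M)) linearP. Qed.
Definition rmap (M N : lmodType A) (u : {linear M -> N}) : {linear rs M -> rs N} :=
  linear_of (rmap_linear u).

Lemma fg_restr (M : lmodType A) : fg_module (rs M) -> fg_module M.
Proof.
move=> [m [s [_ sP]]]; exists m, s; split=> // x _.
by have [c xE] := sP x I; exists (fun i => phi (c i)).
Qed.

Lemma restr_row m :
  exists f : {linear rs 'rV[A]_m.+1 -> (rs A^o * rs 'rV[A]_m)%type},
  bijective f.
Proof.
have fl : linear (fun x : rs 'rV[A]_m.+1 =>
    ((x : 'rV[A]_m.+1) 0 0 : rs A^o,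
     (\row_j (x : 'rV[A]_m.+1) 0 (lift 0 j)) : rs 'rV[A]_m)
    : (rs A^o * rs 'rV[A]_m)%type).
  move=> a x y; congr (_, _); first by rewrite !mxE.
  by apply/rowP => j; rewrite !mxE.
exists (linear_of fl).
exists (fun x : (rs A^o * rs 'rV[A]_m)%type =>
  (\row_j oapp (fun k => (x.2 : 'rV[A]_m) 0 k) (x.1 : A) (unlift 0 j))
    : rs 'rV[A]_m.+1).
  move=> x; apply/rowP => j; rewrite mxE.
  by case: unliftP => [k ->|->] /=; rewrite ?mxE.
move=> [x y]; congr (_, _); first by rewrite mxE unlift_none.
by apply/rowP => j; rewrite !mxE liftK.
Qed.

Lemma restr_row0 : trivial_module (rs 'rV[A]_0).
Proof. by move=> x; apply/rowP; case. Qed.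

Lemma hull_restr_row m : hull (rs A^o) -> hull (rs 'rV[A]_m).
Proof.
move=> hA; elim: m => [|m IH]; first exact/gp_hull/gp_trivial/restr_row0.
have [f fb] := restr_row m.
by apply: hull_iso fb _; exact: hull_prod.
Qed.

Lemma fg_restr_row m : fg_module (rs A^o) -> fg_module (rs 'rV[A]_m).
Proof.
move=> hA; elim: m => [|m IH].
  exists 0%N, (fun=> 0); split=> // x _; exists (fun=> 0).
  by rewrite big_ord0 (restr_row0 x).
have [f /linear_inverse[g [fg gf]]] := restr_row m.
apply: (@fg_surj _ _ _ g) (fg_prod hA IH) => x; by exists (f x).
Qed.

Lemma fg_restr_of (M : lmodType A) :
  fg_module (rs A^o) -> fg_module M -> fg_module (rs M).
Proof.
move=> hA /fg_cover[n [p ps]].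
exact: (@fg_surj _ _ _ (rmap p) ps (fg_restr_row n hA)).
Qed.

Fact act_linear (M : lmodType A) (x : M) :
  linear (fun a : rs A^o => (a : A) *: x : rs M).
Proof.
move=> r a b; rewrite scalerDl; congr (_ + _).
exact: (esym (scalerA (phi r) (a : A) x)).
Qed.
Definition act (M : lmodType A) (x : M) : {linear rs A^o -> rs M} :=
  linear_of (act_linear x).

(** The coordinates of the free module write the identity of a direct summand L as a
    sum of maps that factor through A. *)
Lemma ext_zero_factor_row m i (L : lmodType R) (Q : lmodType R)
    (h : {linear L -> rs 'rV[A]_m}) (p : {linear rs 'rV[A]_m -> L}) :
  cancel h p -> ext_zero i (rs A^o) Q -> ext_zero i L Q.
Proof.
move=> hp hA; have [X pX] := projective_resolution_ex L; exists X; split=> // z.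
have cl k : linear (fun x : L => (h x : 'rV[A]_m) 0 k : rs A^o).
  by move=> a x y; rewrite linearP !mxE.
apply: (@ext_zero_factor _ i L (rs A^o) Q m
  (fun k => p \o act (delta_mx 0 k : 'rV[A]_m)) (fun k => linear_of (cl k))) => // x.
rewrite -{1}(hp x) -linear_sum; congr (p _).
exact: (row_sum_delta (h x : 'rV[A]_m)).
Qed.

(** Dimension shifting along a free cover over A. The kernel is finitely generated
    over R because R is noetherian; this keeps the induction within finitely
    generated modules. *)
Lemma ext_zero_restr n (Q : lmodType R) (M : lmodType A) i :
  noetherian_module (R^o : lmodType R) -> fg_module (rs A^o) ->
  (forall i, (i < n)%N -> ext_zero i (rs A^o) Q) ->
  fg_module (rs M) -> (i < n)%N -> ext_zero i (rs M) Q.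
Proof.
move=> hR fA hA; elim: i M => [|i IH] M fM ni;
    have [m [p ps]] := fg_cover (fg_restr fM);
    have hrow k : (k < n)%N -> ext_zero k (rs 'rV[A]_m) Q
      by move=> kn; exact: (@ext_zero_factor_row m k _ _ idfun idfun _ (hA k kn)).
  have /ext_zero0P h0 := hrow 0 ni; apply/ext_zero0P => f x.
  by have [y <-] := ps x; exact: (h0 (f \o rmap p)).
have [K [j [jI jE]]] := kernel_ex p.
have jp : short_exact (rmap j) (rmap p) by [].
apply: (ext_zero_quotient jp); last exact: hrow.
apply: IH; last exact: ltnW.
exact: (fg_submod hR (jI : injective (rmap j)) (fg_restr_row m fA)).
Qed.

(** A complement L' makes L free over A, so that L x L' has a hull over R. The n-th
    syzygy of L x L' for the sum of two resolutions has a hull and no Ext into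
    projectives, so it is Gorenstein projective; its summand S is so, too. *)
Lemma gp_syz n (L : lmodType A) (X : resolution (rs L)) (S : lmodType R)
    (p : {linear X n -> S}) :
  noetherian_module (R^o : lmodType R) -> fg_module (rs A^o) ->
  finite_gpd (rs A^o) ->
  (forall i, (n < i)%N -> ext_zero i (rs A^o) (R^o : lmodType R)) ->
  fg_module L -> projective L -> projective_resolution X ->
  exact (res_diff X n) p -> surj p -> gorenstein_projective S.
Proof.
move=> hR fA gA hA fL pL pX pE ps.
have [m [c cs]] := fg_cover fL; have [h hP] := pL _ _ c idfun cs.
have hPc y : c (h y) = y := hP y.
have [L' [k [kI kE]]] := kernel_ex c.
have [X' pX'] := projective_resolution_ex (rs L').
have [S' [p' [p's p'E]]] := coker_ex (res_diff X' n).
have [a [b [aE bE ab]]] := prod_ses (rs L) (rs L').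
have epl : linear (fun y : X' 0 => (0, res_aug X' y) : (rs L * rs L')%type).
  by move=> r x y; rewrite -[RHS]/(_, _) /= linearP scaler0 addr0.
pose th i : {linear X' i.+1 -> X i} := \0.
have hep y : b (linear_of epl y) = res_aug X' y by rewrite bE.
have th0 y : a (res_aug X (th 0 y)) = - linear_of epl (res_diff X' 0 y).
  by rewrite /= res_aug0 !linear0; congr (_, _); rewrite oppr0.
have thS i y : res_diff X i (th i.+1 y) = - th i (res_diff X' i.+1 y).
  by rewrite /= linear0 oppr0.
pose H := hs ab hep th0 thS.
have pH : projective_resolution H by exact: hs_projective.
have ql : linear (fun x : H n => (p x.1, p' x.2) : (S * S')%type).
  by move=> r x y; rewrite -[RHS]/(_, _) /= !linearP.
pose q : {linear H n -> (S * S')%type} := linear_of ql.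
have qE : exact (res_diff H n) q.
  move=> [x y]; split=> [e|[[x' y'] [<- <-]]] /=; last first.
    by congr (_, _); [rewrite addr0; apply/pE; exists x' | apply/p'E; exists y'].
  have /pE[x' <-] : p x = 0 := congr1 fst e.
  have /p'E[y' <-] : p' y = 0 := congr1 snd e.
  by exists (x', y'); rewrite /= addr0.
have qs : surj q.
  by move=> [s s']; have [x <-] := ps s; have [y <-] := p's s'; exists (x, y).
(* The section h of c and the kernel k of c split the free module. *)
have fl : linear (fun x : (rs L * rs L')%type => h x.1 + k x.2 : rs 'rV[A]_m).
  move=> r x y; rewrite -[X in h X + _]/(phi r *: (x.1 : L) + (y.1 : L)).
  rewrite -[X in _ + k X]/(phi r *: (x.2 : L') + (y.2 : L')) !linearP.
  by rewrite addrACA -scalerDr.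
pose f : {linear (rs L * rs L')%type -> rs 'rV[A]_m} := linear_of fl.
have kc y : c (k y) = 0 by apply/kE; exists y.
have fI : injective f.
  apply/inj0P => -[x y] /= e.
  have x0 : x = 0.
    by have := congr1 c e; rewrite linearD hPc kc addr0 linear0.
  congr (_, _); first exact: x0.
  by apply: kI; move: e; rewrite x0 !linear0 add0r.
have fs : surj f.
  move=> w; have /kE[y yE] : c ((w : 'rV[A]_m) - h (c w)) = 0.
    by rewrite linearB hPc subrr.
  by exists (c w, y); rewrite /= yE addrC subrK.
have [g [fg gf]] := inverse_ex fI fs.
apply: (@gp_summand _ S S'); apply: hull_perp_gp.
  apply: (hull_syz qE qs pH); apply: (@hull_iso _ _ _ f); first by exists g.
  exact/hull_restr_row/finite_gpd_hull.
move=> Q pQ; apply: (ext_zero_syz qE qs pH) => i.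
apply: (ext_zero_factor_row fg).
have [Y hY] := fg_resolution_ex hR fA.
by apply: (ext_zero_coef hY pQ); apply: hA; rewrite ltnS leq_addr.
Qed.

End Restriction.

(** * Duals and cocycles *)

Section DualMaps.
Variable R : pzRingType.
Implicit Types M N : lmodType R.

Lemma dual_funB M (f g : dual M) x :
  dual_fun (f - g) x = dual_fun f x - dual_fun g x.
Proof. by []. Qed.

Lemma dual_fun_sum M n (f : 'I_n -> dual M) x :
  dual_fun (\sum_i f i) x = \sum_i dual_fun (f i) x.
Proof.
elim: n f => [|n IHn] f; first by rewrite !big_ord0.
by rewrite !big_ord_recl -IHn.
Qed.

Lemma dual_fun0 M (f : dual M) : dual_fun f 0 = 0.
Proof. exact: (linear0 (f : {linear M -> R^o})). Qed.

Lemma dual_mapE M N (u : {linear M -> N}) z x :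
  dual_fun (dual_map u z) x = dual_fun z (u x).
Proof. by []. Qed.

Lemma dual_mapP M N (u : {linear M -> N}) (r : R^c) z w :
  dual_map u (r *: z + w) = r *: dual_map u z + dual_map u w.
Proof. exact: dualP. Qed.

Lemma dual_mapB M N (u : {linear M -> N}) z w :
  dual_map u (z - w) = dual_map u z - dual_map u w.
Proof. exact: dualP. Qed.

Lemma dual_mapD M N (u : {linear M -> N}) z w :
  dual_map u (z + w) = dual_map u z + dual_map u w.
Proof. exact: dualP. Qed.

Lemma dual_map0 M N (u : {linear M -> N}) : dual_map u 0 = 0.
Proof. exact: dualP. Qed.

Lemma dual_map_comp M N (P : lmodType R) (u : {linear M -> N})
    (v : {linear N -> P}) z :
  dual_map u (dual_map v z) = dual_map (v \o u) z.
Proof. exact: dualP. Qed.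

Lemma projective_dual M :
  fg_module M -> projective M -> projective (dual M : lmodType R^c).
Proof.
move=> fM pM U V g f gs; have [n [x [u uE]]] := dual_basis fM pM.
have [w wP] := choice (fun i => gs (f (u i : dual M))).
have hl :
    linear (fun z : dual M => \sum_i (dual_fun z (x i) : R^c) *: w i).
  move=> a y z; rewrite scaler_sumr -big_split; apply: eq_bigr => i _.
  rewrite -[dual_fun (a *: y + z) (x i)]/
    ((a * (dual_fun y (x i) : R^c) + dual_fun z (x i)) : R^c).
  by rewrite scalerDl scalerA.
exists (linear_of hl) => z; rewrite /= linear_sum.
have {2}-> : z = \sum_i (dual_fun z (x i) : R^c) *: (u i : dual M).
  apply: dualP => y; rewrite dual_fun_sum {1}(uE y) /dual_fun linear_sum.
  by apply: eq_bigr => i _; rewrite linearZ.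
by rewrite linear_sum; apply: eq_bigr => i _; rewrite !linearZ wP.
Qed.

Section CocycleModules.
Variables (M : lmodType R) (X : resolution M).

Lemma cocycle_lin i (r : R^c) (z w : dual (X i)) :
  cocycle z -> cocycle w -> cocycle (r *: z + w).
Proof.
by rewrite /cocycle => hz hw; rewrite dual_mapP hz hw scaler0 addr0.
Qed.

Lemma coboundary_lin i (r : R^c) (z w : dual (X i)) :
  coboundary z -> coboundary w -> coboundary (r *: z + w).
Proof.
case: i z w => [|i] z w /=; first by move=> -> ->; rewrite scaler0 addr0.
by move=> [y ->] [y' ->]; exists (r *: y + y'); rewrite dual_mapP.
Qed.

Lemma coboundary0 i : coboundary (0 : dual (X i)).
Proof. by case: i => [|i] //=; exists 0; rewrite dual_map0. Qed.

Lemma coboundary_cocycle i (z : dual (X i)) : coboundary z -> cocycle z.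
Proof. by move/coboundaryP => h; apply/cocycleP; exact: cobound_cocyc h. Qed.

Lemma cocycle_sum i n (z : 'I_n -> dual (X i)) :
  (forall k, cocycle (z k)) -> cocycle (\sum_k z k).
Proof.
move=> h; apply: big_ind => [|y y' hy hy'|k _] //; first exact: dual_map0.
by rewrite -[y]scale1r; exact: cocycle_lin.
Qed.
End CocycleModules.

Lemma cocycle_chain M N (X : resolution M) (Y : resolution N)
    (al : forall i, {linear X i -> Y i}) i (z : dual (Y i)) :
  chain al -> cocycle z -> cocycle (dual_map (al i) z).
Proof.
move=> hal /cocycleP hz; apply/cocycleP.
exact: (cocyc_comp (Q := (R^o : lmodType R)) hal hz).
Qed.

Lemma coboundary_chain M N (X : resolution M) (Y : resolution N)
    (al : forall i, {linear X i -> Y i}) i (z : dual (Y i)) :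
  chain al -> coboundary z -> coboundary (dual_map (al i) z).
Proof.
move=> hal /coboundaryP hz; apply/coboundaryP.
exact: (cobound_comp (Q := (R^o : lmodType R)) hal hz).
Qed.

End DualMaps.

(** * The tensor product as a quotient of cocycles *)

Section Tensor.
Variables (R A : pzRingType) (phi : {rmorphism R -> A}).
Local Notation rs := (restr phi).
Variables (n : nat) (E : bimodule A R).
Variables (P : resolution (rs A^o)) (cls : dual (P n) -> E).
Hypothesis pP : projective_resolution P.
Hypothesis cls_lin : forall (r : R^c) z w, cocycle z -> cocycle w ->
  cls (r *: z + w) = r *: cls z + cls w.
Hypothesis cls_surj : forall e, exists z, cocycle z /\ cls z = e.
Hypothesis cls0 : forall z, cocycle z -> (cls z = 0 <-> coboundary z).
Hypothesis cls_act : forall (a : A) (alpha : forall i, {linear P i -> P i}),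
  (forall x, (res_aug P (alpha 0 x) : A) = (res_aug P x : A) * a) ->
  chain alpha ->
  forall z, cocycle z -> lact a (cls z) = cls (dual_map (alpha n) z).

Variables (L1 L0 : lmodType A) (f : {linear L1 -> L0}).
Variables (T : lmodType A^c) (q : {linear dual L1 -> T}).
Hypotheses (fL1 : fg_module L1) (pL1 : projective L1).
Hypotheses (fL0 : fg_module L0) (pL0 : projective L0).
Hypotheses (qE : exact (dual_map f) q) (qs : surj q).

Variables (Q1 : resolution (rs L1)) (Q0 : resolution (rs L0)).
Hypotheses (pQ1 : projective_resolution Q1) (pQ0 : projective_resolution Q0).
Variable F : forall i, {linear Q1 i -> Q0 i}.
Hypotheses (Fch : chain F) (Flift : lifts (rmap phi f) F).

Variables (X : lmodType R^c) (tau : T -> E -> X).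
Hypothesis hX : is_tensor tau.

Let tauDl t t' e : tau (t + t') e = tau t e + tau t' e.
Proof. by have [[h _ _] _ _] := hX; exact: h. Qed.
Let tauDr t e e' : tau t (e + e') = tau t e + tau t e'.
Proof. by have [[_ h _] _ _] := hX; exact: h. Qed.
Let tauA (a : A) t e : tau ((a : A^c) *: t) e = tau t (lact a e).
Proof. by have [[_ _ h] _ _] := hX; exact: h. Qed.
Let tauZ (r : R^c) t e : tau t (r *: e) = r *: tau t e.
Proof. by have [_ h _] := hX; exact: h. Qed.
Let tau0l e : tau 0 e = 0.
Proof. by apply: (addIr (tau 0 e)); rewrite -tauDl !add0r. Qed.
Let tau0r t : tau t 0 = 0.
Proof. by apply: (addIr (tau t 0)); rewrite -tauDr !add0r. Qed.
Let tau_suml m (t : 'I_m -> T) e : tau (\sum_k t k) e = \sum_k tau (t k) e.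
Proof.
elim: m t => [|m IHm] t; first by rewrite !big_ord0 tau0l.
by rewrite !big_ord_recl tauDl IHm.
Qed.

Let cls_eq z w : cocycle z -> cocycle w -> cls z = cls w -> coboundary (z - w).
Proof.
move=> hz hw e; have e' : z - w = (-1) *: w + z by rewrite scaleN1r addrC.
rewrite e'; apply/cls0; first exact: cocycle_lin.
by rewrite cls_lin // e scaleN1r addNr.
Qed.

(** The cocycles of Q1 that vanish in the cokernel of Ext(L0, R) -> Ext(L1, R). *)
Definition null_cocycle (g : dual (Q1 n)) :=
  exists (y : dual (Q1 n)) (g0 : dual (Q0 n)),
  [/\ coboundary y, cocycle g0 & g = y + dual_map (F n) g0].

Lemma null_submodule : is_submodule null_cocycle.
Proof.
split; first by exists 0, 0; split; rewrite ?dual_map0 ?addr0 //;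
  [exact: coboundary0 | exact: dual_map0].
move=> r _ _ [y [g [hy hg ->]]] [y' [g' [hy' hg' ->]]].
exists (r *: y + y'), (r *: g + g'); split; first exact: coboundary_lin.
  exact: cocycle_lin.
by rewrite dual_mapP scalerDr addrACA.
Qed.

Let null_of_coboundary y : coboundary y -> null_cocycle y.
Proof. by exists y, 0; split=> //; [exact: dual_map0 | rewrite dual_map0 addr0]. Qed.

Let lift1 (u : dual L1) := lift_ex P (rmap phi (u : {linear L1 -> A^o})) pQ1.

(** Lifts of u and of u' differ, up to homotopy, by a chain map that factors through
    Q0, and cocycles with the same class by a coboundary. *)
Let null_diff (u u' : dual L1) (v v' : forall i, {linear Q1 i -> P i}) z z' :
  q u = q u' -> lifts (rmap phi (u : {linear L1 -> A^o})) v -> chain v ->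
  lifts (rmap phi (u' : {linear L1 -> A^o})) v' -> chain v' ->
  cocycle z -> cocycle z' -> cls z = cls z' ->
  null_cocycle (dual_map (v n) z - dual_map (v' n) z').
Proof.
move=> quu vl vc vl' vc' hz hz' e.
have /qE[w wE] : q (u - u') = 0 by rewrite linearB quu subrr.
have [w' [wl wc]] := lift_ex P (rmap phi (w : {linear L0 -> A^o})) pQ0.
have wF x : dual_fun u x - dual_fun u' x = dual_fun w (f x).
  by rewrite -dual_funB -wE.
exists (dual_map (v n) (z - z') +
    (dual_map (v n) z' - dual_map (v' n) z' -
      dual_map (F n) (dual_map (w' n) z'))),
  (dual_map (w' n) z').
split; last 1 first.
- by rewrite dual_mapB -addrA subrK addrA subrK.
- rewrite -[X in coboundary (X + _)]scale1r; apply: coboundary_lin.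
    exact/(coboundary_chain vc)/cls_eq.
  apply/coboundaryP.
  pose al i : {linear Q1 i -> P i} := v i \- v' i \- (w' i \o F i).
  have := @null_cobound _ _ _ Q1 P (R^o : lmodType R) al n z' pQ1 _ _ _.
  set C := cobound _.
  have -> : C = cobound (dual_fun (dual_map (v n) z' - dual_map (v' n) z' -
      dual_map (F n) (dual_map (w' n) z')) : Q1 n -> (R^o : lmodType R)).
    by rewrite /C; congr cobound; apply/funext => x; rewrite /= !linearB.
  apply.
  + by move=> i x; rewrite /= !linearB vc vc' wc Fch.
  + move=> x; rewrite /= !linearB vl vl' wl Flift.
    by apply/eqP; rewrite subr_eq0; apply/eqP; exact: wF.
  exact/cocycleP.
exact: cocycle_chain.
Qed.

(** The inverse of the canonical map from T (x) E to the cokernel, defined on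
    cocycles by means of a dual basis of L1. *)
Section Theta.
Variables (m : nat) (x : 'I_m -> L1) (u : 'I_m -> dual L1).
Hypothesis ux : forall y, y = \sum_k (dual_fun (u k) y : A) *: x k.
Variable rho : 'I_m -> forall i, {linear P i -> Q1 i}.
Hypothesis rhol : forall k, lifts (act phi (x k)) (rho k).
Hypothesis rhoc : forall k, chain (rho k).

Definition theta (g : dual (Q1 n)) : X :=
  \sum_k tau (q (u k)) (cls (dual_map (rho k n) g)).

Let theta_lin (r : R^c) g g' : cocycle g -> cocycle g' ->
  theta (r *: g + g') = r *: theta g + theta g'.
Proof.
move=> hg hg'; rewrite /theta scaler_sumr -big_split; apply: eq_bigr => k _ /=.
rewrite dual_mapP cls_lin ?tauDr ?tauZ //; exact: cocycle_chain.
Qed.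

Let theta_cobound y : coboundary y -> theta y = 0.
Proof.
move=> hy; apply: big1 => k _.
have hk := coboundary_chain (@rhoc k) hy.
by rewrite [cls _](_ : _ = 0) ?tau0r //; apply/cls0 => //; exact: coboundary_cocycle.
Qed.

(** The composites of v with the lifts rho k act on the class of z as the elements
    w (x k) of A, and these are the coordinates of w in the dual basis. *)
Let theta_pull (w : dual L1) (v : forall i, {linear Q1 i -> P i}) z :
  lifts (rmap phi (w : {linear L1 -> A^o})) v -> chain v -> cocycle z ->
  theta (dual_map (v n) z) = tau (q w) (cls z).
Proof.
move=> vl vc hz.
have wE : w = \sum_k (dual_fun w (x k) : A^c) *: u k.
  apply: dualP => y; rewrite dual_fun_sum {1}(ux y) /dual_fun linear_sum.
  by apply: eq_bigr => k _; rewrite linearZ.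
rewrite [in RHS]wE linear_sum tau_suml; apply: eq_bigr => k _.
rewrite linearZ /= tauA; congr (tau _ _).
rewrite dual_map_comp.
rewrite (@cls_act (dual_fun w (x k)) (fun i => v i \o rho k i)) //.
  move=> a; rewrite /= vl rhol /=.
  exact: (linearZ_LR (w : {linear L1 -> A^o}) (res_aug P a : A) (x k)).
by move=> i a /=; rewrite vc rhoc.
Qed.

Let theta_null g : null_cocycle g -> theta g = 0.
Proof.
move=> [y [g0 [hy hg0 ->]]].
have hF := cocycle_chain Fch hg0.
rewrite -[y]scale1r theta_lin ?scale1r //; last exact: coboundary_cocycle.
rewrite theta_cobound // add0r.
(* A dual basis of L0 writes g0, up to a coboundary, as a sum of pullbacks of
   cocycles of P, for which theta_pull applies. *)
have [m0 [x0 [u0 u0E]]] := dual_basis fL0 pL0.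
have [b bP] := choice (fun k => lift_ex Q0 (act phi (x0 k)) pP).
have [v vP] := choice (fun k => lift_ex P (rmap phi (u0 k)) pQ0).
pose z k := dual_map (b k n) g0.
have hz k : cocycle (z k) by apply: cocycle_chain hg0; case: (bP k).
have vFc k : chain (fun i => v k i \o F i).
  by move=> i a /=; rewrite (vP k).2 Fch.
pose w k := dual_map (v k n \o F n) (z k).
have hw k : cocycle (w k) by exact: (cocycle_chain (vFc k) (hz k)).
have w0 k : theta (w k) = 0.
  rewrite /w (@theta_pull (dual_map f (u0 k)) (fun i => v k i \o F i)) //.
    rewrite [q _](_ : _ = 0) ?tau0l //; apply/qE; by exists (u0 k).
    by move=> a /=; rewrite (vP k).1 Flift.
  exact: hz.
have sw0 : theta (\sum_k w k) = 0.
  suff [] : cocycle (\sum_k w k) /\ theta (\sum_k w k) = 0 by [].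
  apply: (big_ind (fun y => cocycle y /\ theta y = 0))
    => [|y1 y2 [h1 e1] [h2 e2]|k' _].
  - split; first exact: dual_map0.
    by apply: theta_cobound; exact: coboundary0.
  - rewrite -[y1]scale1r; split; first exact: cocycle_lin.
    by rewrite theta_lin // e1 e2 scaler0 addr0.
  by split; [exact: hw | exact: w0].
have hsw : cocycle (\sum_k w k) by apply: cocycle_sum.
rewrite -[dual_map (F n) g0](subrK (\sum_k w k)) -[_ - _]scale1r theta_lin //.
- rewrite sw0 addr0 theta_cobound ?scaler0 //.
  apply/coboundaryP.
  pose s i := sval (cid (linear_sum_ex (fun k => b k i \o v k i))).
  have sP i a : s i a = \sum_k b k i (v k i a).
    exact: (svalP (cid (linear_sum_ex (fun k => b k i \o v k i)))).
  have sc : chain s.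
    move=> i a; rewrite !sP linear_sum; apply: eq_bigr => k _ /=.
    by rewrite (bP k).2 (vP k).2.
  have sl : lifts id s.
    move=> a; rewrite sP linear_sum [in RHS](u0E (res_aug Q0 a : L0)).
    by apply: eq_bigr => k _ /=; rewrite (bP k).1 (vP k).1.
  have := @lift_unique _ _ _ Q0 Q0 (R^o : lmodType R) id (fun=> idfun) s n g0 pQ0.
  move=> /(_ _ sc _ sl) h.
  have {}h := h (fun _ _ => erefl) (fun _ => erefl) ((cocycleP _).1 hg0).
  have := cobound_comp Fch h.
  apply: eq_cobound => a.
  by rewrite dual_funB dual_fun_sum /= sP /dual_fun linear_sum.
- rewrite -[dual_map (F n) g0]scale1r -scaleN1r addrC.
  by apply: cocycle_lin; rewrite ?scale1r.
Qed.

(** The universal property gives a map h from X to the quotient V of the cochains by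
    the null cocycles; h (theta g) is the class of g because the maps
    y |-> u k (y) x k of L1 sum to the identity. *)
Let theta_inj g : cocycle g -> theta g = 0 -> null_cocycle g.
Proof.
move=> hg g0.
have [V [p [_ pE]]] := quo_ex null_submodule.
have [ut utP] := choice qs.
have [ze zeP] := choice cls_surj.
have [v vP] := choice (fun t => lift1 (ut t)).
pose b t e := p (dual_map (v t n) (ze e)).
have bE (w : dual L1) (v' : forall i, {linear Q1 i -> P i}) z :
    lifts (rmap phi (w : {linear L1 -> A^o})) v' -> chain v' -> cocycle z ->
    b (q w) (cls z) = p (dual_map (v' n) z).
  move=> vl vc hz; apply/eqP; rewrite -subr_eq0 -linearB; apply/eqP/pE.
  apply: (@null_diff (ut (q w)) w (v (q w)) v') => //.
  - exact: (vP (q w)).1.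
  - exact: (vP (q w)).2.
  - exact: (zeP (cls z)).1.
  exact: (zeP (cls z)).2.
have bal : balanced b.
  split.
  - move=> t t' e; rewrite -[t]utP -[t']utP -[e](zeP e).2 -linearD.
    have hz := (zeP e).1.
    rewrite (@bE (ut t + ut t') (fun i => v t i \+ v t' i)) //; last 2 first.
    + by move=> a; rewrite /= linearD (vP t).1 (vP t').1.
    + by move=> i a; rewrite /= linearD (vP t).2 (vP t').2.
    rewrite (@bE (ut t) (v t)) ?(@bE (ut t') (v t')) //;
      try exact: (vP _).1; try exact: (vP _).2.
    rewrite -linearD; congr (p _); apply: dualP => a.
    exact: (linearD (ze e : {linear P n -> R^o})).
  - move=> t e e'; rewrite -[t]utP -[e](zeP e).2 -[e'](zeP e').2.
    have hz := (zeP e).1; have hz' := (zeP e').1.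
    have hzz : cocycle (ze e + ze e').
      by rewrite -[ze e]scale1r; exact: cocycle_lin.
    have -> : cls (ze e) + cls (ze e') = cls (ze e + ze e').
      by rewrite -[ze e in RHS]scale1r cls_lin // scale1r.
    rewrite !(@bE (ut t) (v t)) //; try exact: (vP _).1; try exact: (vP _).2.
    by rewrite -linearD dual_mapD.
  move=> a t e; rewrite -[t]utP -[e](zeP e).2.
  have hz := (zeP e).1.
  have al_lin : linear (fun y : rs A^o => ((y : A) * a : A) : rs A^o).
    by move=> r y y'; rewrite mulrDl; congr (_ + _); apply/esym/mulrA.
  have [al [all alc]] := lift_ex P (linear_of al_lin) pP.
  have -> : lact a (cls (ze e)) = cls (dual_map (al n) (ze e)).
    by apply: cls_act => // y; rewrite all.
  have -> : (a : A^c) *: q (ut t) = q ((a : A^c) *: ut t) by rewrite linearZ.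
  have [vl vc] := vP t.
  rewrite (@bE (ut t) (v t)) //; last exact: cocycle_chain.
  rewrite (@bE _ (fun i => al i \o v t i)) ?dual_map_comp //.
  - by move=> y; rewrite /= all vl.
  by move=> i y; rewrite /= alc vc.
have [_ _ univ] := hX; have [h [hE _]] := univ _ b bal.
apply/pE.
have -> : p g = h (theta g); last by rewrite g0 raddf0.
rewrite raddf_sum.
have vk k : exists w : forall i, {linear Q1 i -> P i},
    lifts (rmap phi (u k : {linear L1 -> A^o})) w /\ chain w by exact: lift1.
have [w wP] := choice vk.
under eq_bigr => k _.
  rewrite hE (@bE _ (w k));
    [|exact: (wP k).1|exact: (wP k).2|exact: cocycle_chain].
  over.
rewrite -linear_sum; apply/eqP; rewrite -subr_eq0 -linearB; apply/eqP/pE.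
apply: null_of_coboundary; apply/coboundaryP.
pose s i := sval (cid (linear_sum_ex (fun k => rho k i \o w k i))).
have sP i a : s i a = \sum_k rho k i (w k i a).
  exact: (svalP (cid (linear_sum_ex (fun k => rho k i \o w k i)))).
have sc : chain s.
  move=> i a; rewrite !sP linear_sum; apply: eq_bigr => k _ /=.
  by rewrite rhoc (wP k).2.
have sl : lifts id s.
  move=> a; rewrite sP linear_sum [in RHS](ux (res_aug Q1 a : L1)).
  by apply: eq_bigr => k _ /=; rewrite rhol (wP k).1.
have := @lift_unique _ _ _ Q1 Q1 (R^o : lmodType R) id (fun=> idfun) s n g pQ1.
move=> /(_ _ sc _ sl) hh.
have := hh (fun _ _ => erefl) (fun _ => erefl) ((cocycleP _).1 hg).
apply: eq_cobound => a.
by rewrite dual_funB dual_fun_sum /= sP /dual_fun linear_sum.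
Qed.

(** The image of theta contains the pure tensors, so X modulo this image is zero by
    the uniqueness part of the universal property. *)
Let theta_surj y : exists g, cocycle g /\ theta g = y.
Proof.
pose I y := exists g, cocycle g /\ theta g = y.
have hI : is_submodule I.
  split.
    exists 0; split; first exact: dual_map0.
    by apply: theta_cobound; exact: coboundary0.
  move=> r _ _ [g [hg <-]] [g' [hg' <-]]; exists (r *: g + g').
  by split; [exact: cocycle_lin | rewrite theta_lin].
have [V [p [_ pE]]] := quo_ex hI; apply/pE.
have [_ _ univ] := hX.
have bal : balanced (fun (t : T) (e : E) => 0 : V).
  by split=> *; rewrite ?addr0.
have [h [_ hU]] := univ V _ bal.
have -> : p y = h y.
  apply: hU => t e; apply/pE.
  have [w <-] := qs t; have [z [hz <-]] := cls_surj e.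
  have [v [vl vc]] := lift1 w.
  by exists (dual_map (v n) z); split; [exact: cocycle_chain | exact: theta_pull].
apply/esym; exact: (hU \0 (fun _ _ => erefl) y).
Qed.

Lemma thetaP : [/\ forall (r : R^c) g g', cocycle g -> cocycle g' ->
      theta (r *: g + g') = r *: theta g + theta g',
    forall y, exists g, cocycle g /\ theta g = y
  & forall g, cocycle g -> theta g = 0 <-> null_cocycle g].
Proof. by split=> // g hg; split; [exact: theta_inj | exact: theta_null]. Qed.
End Theta.

(** As the functor T |-> T (x) E is right exact and takes Hom(L, A) to Ext(L, R) for
    finitely generated projective L, the tensor product is the cokernel of
    Ext(L0, R) -> Ext(L1, R). *)
Lemma tensor_cocycles : exists th : dual (Q1 n) -> X,
  [/\ forall (r : R^c) g g', cocycle g -> cocycle g' ->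
      th (r *: g + g') = r *: th g + th g',
    forall y, exists g, cocycle g /\ th g = y
  & forall g, cocycle g -> th g = 0 <-> null_cocycle g].
Proof.
have [m [x [u uE]]] := dual_basis fL1 pL1.
have [rho rhoP] := choice (fun k => lift_ex Q1 (act phi (x k)) pP).
exists (theta (u : 'I_m -> dual L1) rho).
by apply: thetaP => [|k|k]; [exact: uE | case: (rhoP k) | case: (rhoP k)].
Qed.

End Tensor.

(** * The kernel of the map to the tensor product *)

Section CocyclesPd.
Variable R : pzRingType.

(** As the cohomology vanishes up to degree k, the cocycles in degree k are resolved
    by the duals of Y_(k-1), ..., Y_0. *)
Lemma pd_cocycles k (N : lmodType R) (Y : resolution N) (Z : lmodType R^c)
    (j : {linear Z -> dual (Y k)}) :
  (forall i, fg_module (Y i) /\ projective (Y i)) ->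
  (forall i, (i <= k)%N -> ext_zero i N (R^o : lmodType R)) ->
  injective j -> exact j (dual_map (res_diff Y k)) -> pd_le (k%:Z - 1) Z.
Proof.
move=> hY; have pY : projective_resolution Y by move=> i; case: (hY i).
elim: k Z j => [|k IH] Z j hN jI jE.
  apply: pd_le_trivial => z; apply: jI; rewrite linear0.
  have jz : cocycle (j z : dual (Y 0)) by apply/jE; exists z.
  apply/(coboundaryP (X := Y) (i := 0)).
  by apply: (ext_zeroP pY (hN 0 isT) (z := j z)); apply/cocycleP.
have [K [i [iI iE]]] := kernel_ex (dual_map (res_diff Y k)).
have [|p pP] := factor_inj (f := dual_map (res_diff Y k)) jI.
  move=> y; apply/jE.
  by apply: (coboundary_cocycle (i := k.+1)); exists y.
have ip : short_exact i p.
  split=> // [y|z].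
    rewrite -iE -pP; split=> [->|e]; first by rewrite linear0.
    by apply: jI; rewrite e linear0.
  have jz : cocycle (j z : dual (Y k.+1)) by apply/jE; exists z.
  have [y yP] :=
    ext_zeroP pY (hN k.+1 (leqnn _)) (z := j z) ((cocycleP _).1 jz).
  exists (y : dual (Y k)); apply: jI; rewrite pP; apply: dualP => x.
  by rewrite /dual_fun /= yP.
apply: (pd_le_step ip); first by apply: projective_dual; case: (hY k).
by apply: (IH K i) => // l lk; apply: hN; exact: leqW.
Qed.

End CocyclesPd.

(** For a map f from L1 to L0 with kernel K, image Z and cokernel M, the horseshoe
    resolutions of L1 and L0 share the terms of a resolution Y2 of Z. The projection
    to these terms lifts f, and its kernel is a resolution of K. *)
Section Horseshoes.
Variable R : pzRingType.
Local Notation RR := (R^o : lmodType R).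
Variables (L1 L0 M K Z : lmodType R).
Variables (k : {linear K -> L1}) (e : {linear L1 -> Z}).
Variables (i : {linear Z -> L0}) (p : {linear L0 -> M}).
Hypotheses (ke : short_exact k e) (ip : short_exact i p).
Variables (Y1 : resolution K) (Y2 : resolution Z) (Y3 : resolution M).
Hypothesis hY1 : forall l, fg_module (Y1 l) /\ projective (Y1 l).
Hypothesis pY2 : projective_resolution Y2.
Hypothesis pY3 : projective_resolution Y3.
Variables (th1 : forall l, {linear Y2 l.+1 -> Y1 l}) (ep1 : {linear Y2 0 -> L1}).
Hypothesis hep1 : forall b, e (ep1 b) = res_aug Y2 b.
Hypothesis h10 : forall b, k (res_aug Y1 (th1 0 b)) = - ep1 (res_diff Y2 0 b).
Hypothesis h1S :
  forall l b, res_diff Y1 l (th1 l.+1 b) = - th1 l (res_diff Y2 l.+1 b).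
Variables (th0 : forall l, {linear Y3 l.+1 -> Y2 l}) (ep0 : {linear Y3 0 -> L0}).
Hypothesis hep0 : forall b, p (ep0 b) = res_aug Y3 b.
Hypothesis h00 : forall b, i (res_aug Y2 (th0 0 b)) = - ep0 (res_diff Y3 0 b).
Hypothesis h0S :
  forall l b, res_diff Y2 l (th0 l.+1 b) = - th0 l (res_diff Y3 l.+1 b).

Definition hs_source := hs ke hep1 h10 h1S.
Definition hs_target := hs ip hep0 h00 h0S.

Fact hsF_linear l : linear (fun x : hs_source l => (x.2, 0) : hs_target l).
Proof. by move=> a x y; rewrite -[RHS]/(_, _) /= scaler0 addr0. Qed.
Definition hsF l : {linear hs_source l -> hs_target l} := linear_of (@hsF_linear l).

Lemma hsF_chain : chain hsF.
Proof. by move=> l [a b]; rewrite /= !linear0 addr0. Qed.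

Lemma hsF_lifts : lifts (fun x => i (e x)) hsF.
Proof.
move=> [a b]; rewrite /= linear0 addr0 linearD hep1.
have [_ kE _] := ke.
by rewrite [e (k _)](_ : _ = 0) ?add0r //; apply/kE; exists (res_aug Y1 a).
Qed.

Section Transpose.
Variables (n : nat) (G1 G0 S : lmodType R).
Variables (p1 : {linear hs_source n -> G1}) (p0 : {linear hs_target n -> G0}).
Variable pS : {linear Y3 n -> S}.
Hypotheses (p1s : surj p1) (p1E : exact (res_diff hs_source n) p1).
Hypotheses (p0s : surj p0) (p0E : exact (res_diff hs_target n) p0).
Hypotheses (pSs : surj pS) (pSE : exact (res_diff Y3 n) pS).

(** The cokernels G1, G0 and S of the differentials in degree n are syzygies of L1,
    L0 and M; the presentation of M induces one of S. *)
Lemma syz_presentation :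
  exists (ph : {linear G1 -> G0}) (ps : {linear G0 -> S}),
  (forall x, ph (p1 x) = p0 (hsF n x)) /\ (exact ph ps /\ surj ps).
Proof.
have [|ph phP] := factor_surj (f := p0 \o hsF n) p1s.
  move=> x /p1E[y <-] /=; apply/p0E; exists (hsF n.+1 y).
  exact: hsF_chain.
have [|ps psP] := factor_surj (f := pS \o snd) p0s.
  by move=> x /p0E[[b c] <-] /=; apply/pSE; exists c.
exists ph, ps; split=> //; split=> [g|s].
  have [[b c] <-] := p0s g; split=> [|[g1 <-]].
    rewrite psP => /pSE[c' /= c'E].
    exists (p1 (0, b - th0 n c')); rewrite phP /=.
    apply/eqP; rewrite -subr_eq0 -linearB; apply/eqP/p0E; exists (0, - c').
    rewrite /= !linearN linear0 add0r c'E -[RHS]/(_, _) /=.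
    by rewrite add0r addrAC subrr add0r.
  have [x <-] := p1s g1; rewrite phP psP /= linear0; by [].
by have [c <-] := pSs s; exists (p0 (0, c)); rewrite psP.
Qed.

Variables (X G : lmodType R^c) (ph : {linear G1 -> G0}).
Hypothesis phP : forall x, ph (p1 x) = p0 (hsF n x).
Variables (qG : {linear dual G1 -> G}).
Hypotheses (qGs : surj qG) (qGE : exact (dual_map ph) qG).
Variable th : dual (hs_source n) -> X.
Hypothesis th_lin : forall (r : R^c) g g', cocycle g -> cocycle g' ->
  th (r *: g + g') = r *: th g + th g'.
Hypothesis th_surj : forall y, exists g, cocycle g /\ th g = y.
Hypothesis th_ker : forall g, cocycle g -> th g = 0 <->
  exists (y : dual (hs_source n)) (g0 : dual (hs_target n)),
  [/\ coboundary y, cocycle g0 & g = y + dual_map (hsF n) g0].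

Lemma cocycle_p1 (z : dual G1) : cocycle (dual_map p1 z).
Proof.
apply: dualP => x; rewrite !dual_mapE [p1 _](_ : _ = 0) ?dual_fun0 //.
by apply/p1E; exists x.
Qed.

Lemma cocycle_p1_ex (g : dual (hs_source n)) :
  cocycle g -> exists z, g = dual_map p1 z.
Proof.
move=> /cocycleP hg; have [|z zP] := factor_surj (f := g) p1s.
  by move=> x /p1E[y <-]; exact: hg.
by exists z; apply: dualP => x; exact/esym/zP.
Qed.

Lemma cocycle_p0_ex (g : dual (hs_target n)) :
  cocycle g -> exists z, g = dual_map p0 z.
Proof.
move=> /cocycleP hg; have [|z zP] := factor_surj (f := g) p0s.
  by move=> x /p0E[y <-]; exact: hg.
by exists z; apply: dualP => x; exact/esym/zP.
Qed.

Lemma dual_p1_inj : injective (dual_map p1).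
Proof.
move=> z z' e'; apply: dualP => g; have [x <-] := p1s g.
exact: (congr1 (fun w : dual _ => dual_fun w x) e').
Qed.

Lemma hF_p (z : dual G0) :
  dual_map (hsF n) (dual_map p0 z) = dual_map p1 (dual_map ph z).
Proof. by apply: dualP => x; rewrite !dual_mapE phP. Qed.

Lemma qG_zero (z : dual G1) (z0 : dual (hs_target n)) : cocycle z0 ->
  dual_map p1 z = dual_map (hsF n) z0 -> qG z = 0.
Proof.
move=> /cocycle_p0_ex[w ->]; rewrite hF_p => /dual_p1_inj->.
by apply/qGE; exists w.
Qed.

Lemma transpose_map : exists g : {linear G -> X},
  (forall z, g (qG z) = th (dual_map p1 z)) /\ surj g.
Proof.
have tl : linear (fun z : dual G1 => th (dual_map p1 z)).
  by move=> r z z'; rewrite dual_mapP; apply: th_lin; exact: cocycle_p1.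
have [|g gP] := factor_surj (f := linear_of tl) qGs.
  move=> z /qGE[w <-] /=; apply/th_ker; first exact: cocycle_p1.
  exists 0, (dual_map p0 w); split; first exact: coboundary0.
    apply: dualP => x; rewrite !dual_mapE [p0 _](_ : _ = 0) ?dual_fun0 //.
    by apply/p0E; exists x.
  by rewrite hF_p add0r.
exists g; split=> // y; have [z [hz <-]] := th_surj y.
by have [w ->] := cocycle_p1_ex hz; exists (qG w); rewrite gP.
Qed.

End Transpose.

(** The kernel of g consists of the classes of coboundaries on the resolution of L1.
    For n = m + 1, extending functionals on Y1_m by zero and taking coboundaries
    already gives all of these classes, since a functional on Y2_m gives a class
    that comes from L0 and vanishes in G. A functional on Y1_m gives the class zero
    if and only if it is a cocycle; here Ext^m(K, R) = 0 is used. So the kernel of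
    g is the dual of Y1_m modulo the cocycles, and these have projective dimension
    at most m - 1. *)
Lemma pd_transpose_kernel n (G1 G0 : lmodType R)
    (p1 : {linear hs_source n -> G1}) (p0 : {linear hs_target n -> G0})
    (p1s : surj p1) (p1E : exact (res_diff hs_source n) p1)
    (p0s : surj p0) (p0E : exact (res_diff hs_target n) p0)
    (X G : lmodType R^c) (ph : {linear G1 -> G0})
    (phP : forall x, ph (p1 x) = p0 (hsF n x))
    (qG : {linear dual G1 -> G}) (qGs : surj qG) (qGE : exact (dual_map ph) qG)
    (th : dual (hs_source n) -> X)
    (th_ker : forall g, cocycle g -> th g = 0 <->
      exists (y : dual (hs_source n)) (g0 : dual (hs_target n)),
        [/\ coboundary y, cocycle g0 & g = y + dual_map (hsF n) g0])
    (g : {linear G -> X}) (gP : forall z, g (qG z) = th (dual_map p1 z))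
    (Kg : lmodType R^c) (ig : {linear Kg -> G})
    (igI : injective ig) (igE : exact ig g)
    (extK : forall l, (l < n)%N -> ext_zero l K RR) :
  pd_le (n%:Z - 1) Kg.
Proof.
have qG0 := @qG_zero n G1 G0 p1 p0 p1s p0s p0E G ph phP qG qGE.
have c1 := @cocycle_p1 n G1 p1 p1E.
have c1ex := @cocycle_p1_ex n G1 p1 p1s p1E.
have d1I := @dual_p1_inj n G1 p1 p1s.
case: n p1 p0 p1s p1E p0s p0E phP th th_ker gP extK qG0 c1 c1ex d1I
  => [|m] p1 p0 p1s p1E p0s p0E phP th th_ker gP extK qG0 c1 c1ex d1I.
  apply: pd_le_trivial => z; apply: igI; rewrite linear0.
  have [w wE] := qGs (ig z).
  have /th_ker[|y [g0 [y0 hg0 e0]]] : th (dual_map p1 w) = 0.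
  - by rewrite -gP wE; apply/igE; exists z.
  - exact: c1.
  by rewrite -wE; apply: (qG0 w g0) => //; rewrite e0 y0 add0r.
have pY1 : projective_resolution Y1 by move=> l; case: (hY1 l).
pose pr : {linear hs_source m -> Y1 m} := fst.
have [|c cP] := factor_inj
    (f := dual_map (res_diff hs_source m) \o dual_map pr) d1I.
  move=> y; have [|z zP] := c1ex (dual_map (res_diff hs_source m) (dual_map pr y)).
    by apply: coboundary_cocycle; exists (dual_map pr y).
  by exists z.
have vanish (v : dual (Y2 m)) (w : dual G1) :
    (forall a b,
      dual_fun (dual_map p1 w) (a, b) = dual_fun v (res_diff Y2 m b)) ->
    qG w = 0.
  move=> h; pose pr0 : {linear hs_target m -> Y2 m} := fst.
  apply: (qG0 w (dual_map (res_diff hs_target m) (dual_map pr0 v))).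
    by apply: coboundary_cocycle; exists (dual_map pr0 v).
  apply: dualP => -[a b]; rewrite h !dual_mapE /= linear0 addr0; by [].
have [|ka kaP] := factor_inj (f := qG \o c) igI.
  move=> y; apply/igE; rewrite /= gP; apply/th_ker; first exact: c1.
  exists (dual_map p1 (c y)), 0; split; last by rewrite dual_map0 addr0.
    by rewrite cP; exists (dual_map pr y).
  exact: dual_map0.
have [ZK [jj [jjI jjE]]] := kernel_ex (dual_map (res_diff Y1 m)).
have ses : short_exact jj ka.
  split=> // [y|z].
    rewrite -jjE; split=> [y0|hy].
      have /qGE[w wE] : qG (c y) = 0 by rewrite -[LHS]kaP y0 linear0.
      apply: dualP => a; rewrite dual_mapE.
      have <- : dual_fun (dual_map p1 (c y)) (a, 0) =
          dual_fun y (res_diff Y1 m a).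
        rewrite cP -[LHS]/(dual_fun y (res_diff Y1 m a + th1 m 0)).
        by rewrite linear0 addr0.
      rewrite -wE !dual_mapE phP [p0 _](_ : _ = 0) ?dual_fun0 //.
      exact: linear0.
    apply: igI; rewrite linear0 kaP /=.
    have hc := ext_zeroP pY1 (extK m (ltnSn m)) (z := y) ((cocycleP _).1 hy).
    have [v vP] := @hs_restrict _ _ _ _ _ _ _ _ _ _ ke hep1 h10 h1S RR m
      (dual_map pr y : {linear hs_source m -> RR}) hc.
    by apply: (vanish v) => a b; rewrite cP; exact: (vP (a, b)).
  have [w wE] := qGs (ig z).
  have /th_ker[|y [g0 [[y' ->] hg0 e0]]] : th (dual_map p1 w) = 0.
  - by rewrite -gP wE; apply/igE; exists z.
  - exact: c1.
  pose il : {linear Y1 m -> hs_source m} := inl_lin (Y1 m) (Y2 m).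
  pose ir : {linear Y2 m -> hs_source m} := inr_lin (Y1 m) (Y2 m).
  exists (dual_map il y'); apply: igI; rewrite kaP /= -wE.
  have [w0 w0E] := @cocycle_p0_ex m.+1 G0 p0 p0s p0E g0 hg0.
  have phw0 : qG (dual_map ph w0) = 0 by apply/qGE; exists w0.
  suff h : qG (w - c (dual_map il y') - dual_map ph w0) = 0.
    have : qG w - qG (c (dual_map il y')) - qG (dual_map ph w0) = 0.
      by rewrite -!linearB.
    by rewrite phw0 subr0 => /eqP; rewrite subr_eq0 => /eqP.
  apply: (vanish (dual_map ir y')) => a b.
  have -> : dual_map p1 (w - c (dual_map il y') - dual_map ph w0) =
      dual_map (res_diff hs_source m) (y' - dual_map pr (dual_map il y')).
    rewrite !dual_mapB e0 cP w0E.
    rewrite (@hF_p m.+1 G1 G0 p1 p0 ph phP w0) addrAC addrK.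
    by [].
  have sp (x : hs_source m) :
      dual_fun y' x = dual_fun y' (x.1, 0) + dual_fun y' (0, x.2).
    case: x => x1 x2; rewrite [LHS](congr1 (dual_fun y') (pair_split x1 x2)).
    exact: (linearD (y' : {linear hs_source m -> RR}) (x1, 0) (0, x2)).
  by rewrite dual_mapE dual_funB sp addrC; exact: addKr.
apply: (pd_le_step ses); first by apply: projective_dual; case: (hY1 m).
by apply: (pd_cocycles hY1 _ jjI jjE) => l lm; exact: extK.
Qed.

End Horseshoes.

Theorem theorem1p1 (R A : pzRingType) (phi : {rmorphism R -> A})
    (hR : noetherian_ring R) (hphi : finite_morphism phi)
    (hA : finite_gpd (restr phi A^o))
    (n : nat) (hext : forall i : nat, i <> n -> ext_vanishes i (restr phi A^o))
    (E : bimodule A R) (hE : is_ext_bimodule phi n E)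
    (M : lmodType A) (hM : fg_module M)
    (T : lmodType A^c) (hT : is_transpose M T)
    (X : lmodType R^c) (tau : T -> E -> X) (hX : is_tensor tau) :
  exists S : lmodType R, is_syzygy n (restr phi M) S /\
  exists G : lmodType R^c, is_gorenstein_transpose S G /\
  exists (K : lmodType R^c) (f : {linear K -> G}) (g : {linear G -> X}),
    short_exact f g /\ pd_le (n%:Z - 1) K.
Proof.
have [hRl _] := hR; have [fA _] := hphi.
have hext' i : i <> n -> ext_zero i (restr phi A^o) (R^o : lmodType R).
  by move=> /hext; exact: ext_vanishesE.
have [L1 [L0 [f [p [q [[fL1 pL1] [fL0 pL0] [fp ps] [fq qs]]]]]]] := hT.
have [P [cls [pP [cls_lin cls_surj cls0 cls_act]]]] := hE.
have [Z [e [i [es iI ie]]]] := image_ex f.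
have [K [k [kI kE]]] := kernel_ex e.
have ke : short_exact (rmap phi k) (rmap phi e) by [].
have ip : short_exact (rmap phi i) (rmap phi p).
  split=> // y; rewrite (fp y); split=> [[x <-]|[z <-]].
    by exists (e x); exact: ie.
  by have [x <-] := es z; exists x; rewrite /= ie.
have rL1 := fg_restr_of fA fL1; have rL0 := fg_restr_of fA fL0.
have fK : fg_module (restr phi K).
  exact: (fg_submod hRl (kI : injective (rmap phi k)) rL1).
have fZ : fg_module (restr phi Z) by exact: (@fg_surj _ _ _ (rmap phi e) es rL1).
have fM : fg_module (restr phi M) by exact: (@fg_surj _ _ _ (rmap phi p) ps rL0).
have [Y1 hY1] := fg_resolution_ex hRl fK.
have [Y2 hY2] := fg_resolution_ex hRl fZ.
have [Y3 hY3] := fg_resolution_ex hRl fM.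
have pY1 : projective_resolution Y1 by move=> l; case: (hY1 l).
have pY2 : projective_resolution Y2 by move=> l; case: (hY2 l).
have pY3 : projective_resolution Y3 by move=> l; case: (hY3 l).
have [th1 [ep1 [hep1 h10 h1S]]] := horseshoe_ex Y1 ke pY2.
have [th0 [ep0 [hep0 h00 h0S]]] := horseshoe_ex Y2 ip pY3.
pose Q1 := hs_source ke hep1 h10 h1S.
pose Q0 := hs_target ip hep0 h00 h0S.
have pQ1 : projective_resolution Q1 by exact: hs_projective.
have pQ0 : projective_resolution Q0 by exact: hs_projective.
pose F l : {linear Q1 l -> Q0 l} := hsF ke ip hep1 h10 h1S hep0 h00 h0S l.
have Fch : chain F by exact: hsF_chain.
have Flift : lifts (rmap phi f) F.
  move=> x; apply: etrans (ie _).
  exact: (@hsF_lifts R _ _ _ _ _ _ _ _ _ ke ip Y1 Y2 Y3 th1 ep1 hep1 h10 h1S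
    th0 ep0 hep0 h00 h0S x).
have [S [pS [pSs pSE]]] := coker_ex (res_diff Y3 n).
have [G1 [p1 [p1s p1E]]] := coker_ex (res_diff Q1 n).
have [G0 [p0 [p0s p0E]]] := coker_ex (res_diff Q0 n).
have [ph [psi [phP [phE psis]]]] :=
  @syz_presentation R _ _ _ _ _ _ _ _ _ ke ip Y1 Y2 Y3 th1 ep1 hep1 h10 h1S
    th0 ep0 hep0 h00 h0S n G1 G0 S p1 p0 pS p1s p1E p0s p0E pSs pSE.
exists S; split; first exact: is_syzygy_coker pSE pSs hY3.
have [G [qG [qGs qGE]]] := coker_ex (dual_map ph).
have hAn l : (n < l)%N -> ext_zero l (restr phi A^o) (R^o : lmodType R).
  by move=> nl; apply: hext' => ln; rewrite ln ltnn in nl.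
exists G; split.
  exists G1, G0, ph, psi, qG; split=> //.
  - split; last exact: (gp_syz hRl fA hA hAn fL1 pL1 pQ1 p1E p1s).
    by apply: (fg_surj p1s); apply: fg_prod; [case: (hY1 n) | case: (hY2 n)].
  - split; last exact: (gp_syz hRl fA hA hAn fL0 pL0 pQ0 p0E p0s).
    by apply: (fg_surj p0s); apply: fg_prod; [case: (hY2 n) | case: (hY3 n)].
have [th [th_lin th_surj th_ker]] :=
  tensor_cocycles pP cls_lin cls_surj cls0 cls_act fL1 pL1 fL0 pL0 fq qs
    pQ1 pQ0 Fch Flift hX.
have [g [gP gs]] :=
  transpose_map p1s p1E p0E phP qGs qGE th_lin th_surj th_ker.
have [Kg [ig [igI igE]]] := kernel_ex g.
exists Kg, ig, g; split=> //.
apply: (pd_transpose_kernel hY1 p1s p1E p0s p0E phP qGs qGE th_ker gP igI igE).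
move=> l ln; apply: (ext_zero_restr (n := n)) => // l' l'n.
by apply: hext' => e'; rewrite e' ltnn in l'n.
Qed.
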